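(* The group $AMp(V)$ is a central extension of the group $ASp(V)$ by $\mu_4$; in particular it fits into an exact sequence of groups $$1\to\mu_4\to AMp(V)\to ASp(V)\to1,$$ where $AMp(V)\to ASp(V)$ is the projection $(g,\iota)\mapsto g$.
   Context: Let $K$ be an unramified extension of $\mathbb{Q}_2$ of degree $d$, $\mathcal{O}_K$ its ring of integers, $\mathfrak{m}_K=2\mathcal{O}_K$, $k=\mathcal{O}_K/\mathfrak{m}_K=\mathbb{F}_{2^d}$, $R=\mathcal{O}_K/\mathfrak{m}_K^2$, $tr:R\to\mathbb{Z}/4$ the trace, $\psi(z)=e^{\frac{2\pi i}{4}tr(z)}$ for $z\in R$. $\mu_4$ is the group of fourth roots of unity. Let $(\widetilde{V},\widetilde{\omega})$ be a free symplectic $R$-module of rank $2n$, $V=\widetilde{V}/2\widetilde{V}$. The form $2\widetilde{\omega}$ factors to a non-degenerate skew-symmetric form $\omega:V\times V\to R$; $Sp(V)$ is the group of $k$-linear automorphisms preserving $\omega$. Fix a splitting $\widetilde{V}=\widetilde{L}_0\times\widetilde{M}_0$ into free Lagrangian submodules; put $\widetilde{\beta}((l_1,m_1),(l_2,m_2))=\widetilde{\omega}(l_1,m_2)$; $2\widetilde{\beta}$ factors to $\beta:V\times V\to R$. The Heisenberg group is $H(V)=V\times R$ with $(v_1,z_1)(v_2,z_2)=(v_1+v_2,z_1+z_2+\beta(v_1,v_2))$, with center $Z=\{0\}\times R$. For $g\in Sp(V)$, $\Sigma_g$ is the set of functions $\alpha:V\to R$ with $\alpha(v_1+v_2)-\alpha(v_1)-\alpha(v_2)=\beta(gv_1,gv_2)-\beta(v_1,v_2)$.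 $ASp(V)=\{(g,\alpha):g\in Sp(V),\alpha\in\Sigma_g\}$ with $(g,\alpha_g)(h,\alpha_h)=(gh,\alpha_g\circ h+\alpha_h)$; $(g,\alpha)$ acts on $H(V)$ by the automorphism $(v,z)\mapsto(gv,z+\alpha(v))$. $ELag(V)$ is the set of enhanced Lagrangians: group homomorphisms $\tau:L\to H(V)$ that are sections of $H(V)\to V$ over a Lagrangian subspace $L\subset V$; such $\tau$ is denoted simply $L$. $ASp(V)$ acts on $ELag(V)$: $g$ sends $\tau:L\to H(V)$ to $gL\to H(V)$, $l\mapsto g(\tau(g^{-1}l))$. For $L\in ELag(V)$, $\mathcal{H}_L$ is the space of $f:H(V)\to\mathbb{C}$ with $f(z\tau(l)h)=\psi(z)f(h)$ for $z\in Z$, $l\in L$, with $H(V)$ acting by right translations. These form a bundle $\mathfrak{H}$ on $ELag(V)$. An $H(V)^m$-vector bundle $\mathfrak{E}$ on $ELag(V)$ is a family of complex vector spaces $\mathfrak{E}_L$, $L\in ELag(V)$, each with an action of $H(V)^m$. A trivialization of it is a system of intertwining isomorphisms $E_{M,L}:\mathfrak{E}_L\to\mathfrak{E}_M$ for all $(M,L)\in ELag(V)^2$ with $E_{N,M}\circ E_{M,L}=E_{N,L}$. For $(M,L)$ in general position ($M+L=V$), $F_{M,L}:\mathcal{H}_L\to\mathcal{H}_M$ is $F_{M,L}[f](h)=\sum_{m\in M}f(\tau(m)h)$. The bundle $\mathfrak{H}^{\otimes4}$ carries the canonical trivialization $\{T_{M,L}\}$, the unique one with $T_{M,L}=\frac{(-1)^{dn}}{|M|^2}F_{M,L}^{\otimes4}$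 for $(M,L)$ in general position. The category (Weil gerbe) $\mathcal{W}$: objects are triples $(\mathfrak{E},\{E_{M,L}\},\varphi)$ with $\mathfrak{E}$ an $H(V)$-vector bundle, $\{E_{M,L}\}$ a trivialization of it, and $\varphi:\mathfrak{E}\to\mathfrak{H}$ an isomorphism of $H(V)$-vector bundles such that $\varphi^{\otimes4}$ is an isomorphism of trivialized bundles $\mathfrak{E}^{\otimes4}\to\mathfrak{H}^{\otimes4}$. Morphisms $\mathfrak{E}_1\to\mathfrak{E}_2$ are morphisms $f$ of trivialized $H(V)$-vector bundles with $\varphi_2^{\otimes4}\circ f^{\otimes4}=\varphi_1^{\otimes4}$. Each $g\in ASp(V)$ acts by the pull-back functor $g^*:\mathcal{W}\to\mathcal{W}$: $(g^*\mathfrak{E})_L=\mathfrak{E}_{gL}$ with $h\in H(V)$ acting as $g(h)$ does on $\mathfrak{E}_{gL}$; trivialization $(g^*E)_{M,L}=E_{gM,gL}$; isomorphism $\varphi^g=\theta_g\circ g^*\varphi$, where $\theta_g:\mathcal{H}_{gL}\to\mathcal{H}_L$, $f\mapsto f\circ g$. $AMp(V)$ is the group of pairs $(g,\iota)$ with $g\in ASp(V)$ and $\iota:g^*\to Id$ an isomorphism of functors $\mathcal{W}\to\mathcal{W}$, with multiplication $(g,\iota_g)\cdot(h,\iota_h)=(gh,\iota_h\circ h^*(\iota_g))$. *)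

(* Defs.v *)
From HB Require Import structures.
From mathcomp Require Import all_boot all_order all_fingroup all_algebra all_field.
From mathcomp Require Import all_classical all_reals all_analysis.
From mathcomp Require Import complex zify ring.

Set Implicit Arguments.
Unset Strict Implicit.
Unset Printing Implicit Defensive.

Import Order.TTheory GRing.Theory Num.Theory.
Local Open Scope ring_scope.

(* The ring Z_2 as the inverse limit of the Z/2^n: coherent sequences of
   reduced residues (the condition forces [res n < 2 ^ n]). *)
Record padic2 := Padic2 {
  res : nat -> nat;
  resP : forall n, (res n.+1 %% 2 ^ n)%N = res n }.

HB.instance Definition _ := gen_eqMixin padic2.
HB.instance Definition _ := gen_choiceMixin padic2.

Section PadicRing.
Implicit Types x y z : padic2.

Lemma res_lt x n : (res x n < 2 ^ n)%N.
Proof. by rewrite -(resP x) ltn_mod expn_gt0. Qed.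

Lemma res_mod x n : (res x n %% 2 ^ n)%N = res x n.
Proof. by rewrite modn_small // res_lt. Qed.

Lemma padic2P x y : res x =1 res y -> x = y.
Proof.
case: x y => [x hx] [y hy] /= /funext exy; case: _ / exy hy => hy.
by congr Padic2; apply: Prop_irrelevance.
Qed.

Definition coherent (u : nat -> nat) := forall n, u n.+1 = u n %[mod 2 ^ n].

Lemma of_coherent_subproof u : coherent u ->
  forall n, (u n.+1 %% 2 ^ n.+1 %% 2 ^ n)%N = (u n %% 2 ^ n)%N.
Proof. by move=> hu n; rewrite modn_dvdm ?hu // expnS dvdn_mull. Qed.

Definition of_coherent u (hu : coherent u) :=
  @Padic2 (fun n => u n %% 2 ^ n)%N (of_coherent_subproof hu).

Lemma res_coherent x : coherent (res x).
Proof. by move=> n; rewrite resP res_mod. Qed.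

Lemma padic2_add_subproof x y : coherent (fun n => res x n + res y n)%N.
Proof. by move=> n; rewrite -modnDm !res_coherent modnDm. Qed.
Definition padic2_add x y := of_coherent (padic2_add_subproof x y).

Lemma padic2_mul_subproof x y : coherent (fun n => res x n * res y n)%N.
Proof. by move=> n; rewrite -modnMm !res_coherent modnMm. Qed.
Definition padic2_mul x y := of_coherent (padic2_mul_subproof x y).

Lemma padic2_opp_subproof x : coherent (fun n => 2 ^ n - res x n)%N.
Proof.
move=> n; apply/eqP; rewrite -(eqn_modDr (res x n.+1)) subnK ?(ltnW (res_lt _ _)) //.
by rewrite -modnDmr res_coherent modnDmr subnK ?(ltnW (res_lt _ _)) // expnS modnn modnMl.
Qed.
Definition padic2_opp x := of_coherent (padic2_opp_subproof x).

Lemma padic2_nat_subproof k : coherent (fun _ => k).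
Proof. by []. Qed.
Definition padic2_nat k := of_coherent (padic2_nat_subproof k).

Fact padic2_addA : associative padic2_add.
Proof. by move=> x y z; apply: padic2P => n /=; rewrite modnDmr modnDml addnA. Qed.
Fact padic2_addC : commutative padic2_add.
Proof. by move=> x y; apply: padic2P => n /=; rewrite addnC. Qed.
Fact padic2_add0 : left_id (padic2_nat 0) padic2_add.
Proof. by move=> x; apply: padic2P => n /=; rewrite mod0n add0n res_mod. Qed.
Fact padic2_addN : left_inverse (padic2_nat 0) padic2_opp padic2_add.
Proof.
move=> x; apply: padic2P => n /=.
by rewrite modnDml subnK ?(ltnW (res_lt _ _)) // modnn mod0n.
Qed.
HB.instance Definition _ :=
  GRing.isZmodule.Build padic2 padic2_addA padic2_addC padic2_add0 padic2_addN.

Fact padic2_mulA : associative padic2_mul.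
Proof. by move=> x y z; apply: padic2P => n /=; rewrite modnMmr modnMml mulnA. Qed.
Fact padic2_mulC : commutative padic2_mul.
Proof. by move=> x y; apply: padic2P => n /=; rewrite mulnC. Qed.
Fact padic2_mul1 : left_id (padic2_nat 1) padic2_mul.
Proof. by move=> x; apply: padic2P => n /=; rewrite modnMml mul1n res_mod. Qed.
Fact padic2_mulD : left_distributive padic2_mul padic2_add.
Proof.
move=> x y z; apply: padic2P => n /=.
by rewrite modnMml modnDm mulnDl.
Qed.
Fact padic2_one_neq0 : padic2_nat 1 != 0.
Proof. by apply/eqP => /(congr1 (fun x => res x 1)). Qed.
HB.instance Definition _ :=
  GRing.Zmodule_isComNzRing.Build padic2 padic2_mulA padic2_mulC padic2_mul1
    padic2_mulD padic2_one_neq0.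

Definition padic2_unit : {pred padic2} := fun x => `[< exists y, y * x = 1 >].
Definition padic2_inv x : padic2 :=
  if x \in padic2_unit then xget 0 [set y | y * x = 1]%classic else x.
Fact padic2_mulVx : {in padic2_unit, left_inverse 1 padic2_inv *%R}.
Proof.
move=> x ux; rewrite /padic2_inv ux; case: xgetP => //= none.
by move/asboolP: ux => [y /none].
Qed.
Fact padic2_unitP x y : y * x = 1 -> x \in padic2_unit.
Proof. by move=> yx; apply/asboolP; exists y. Qed.
Fact padic2_inv_out : {in [predC padic2_unit], padic2_inv =1 id}.
Proof. by move=> x; rewrite inE /padic2_inv => /negPf ->. Qed.
HB.instance Definition _ :=
  GRing.ComNzRing_hasMulInverse.Build padic2 padic2_mulVx padic2_unitP padic2_inv_out.

Lemma res_mod_le x m n : (m <= n)%N -> (res x n %% 2 ^ m)%N = res x m.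
Proof.
move=> /subnKC <-; elim: (n - m)%N => [|k IH]; first by rewrite addn0 res_mod.
rewrite addnS -IH -(resP x (m + k)) [RHS]modn_dvdm //.
by rewrite expnD dvdn_mulr.
Qed.

Fact padic2_idomain x y : x * y = 0 -> (x == 0) || (y == 0).
Proof.
have nz z : z != 0 -> exists m, ~~ (2 ^ m %| res z m)%N.
  move=> z0; apply: contrapT => h; case/eqP: z0; apply: padic2P => n /=.
  rewrite mod0n -res_mod; apply/eqP/negPn/negP => hn.
  by apply: h; exists n.
move=> xy0; apply: contrapT => /negP; rewrite negb_or => /andP[/nz[a ha] /nz[b hb]].
have := congr1 (fun z => res z (a + b)) xy0 => /= /eqP; rewrite mod0n -/(dvdn _ _).
have hle z m n : (m <= n)%N -> ~~ (2 ^ m %| res z m)%N -> ~~ (2 ^ m %| res z n)%N.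
  by move=> mn; rewrite -(res_mod_le z mn) /dvdn modn_mod.
move: (hle x _ _ (leq_addr b a) ha) (hle y _ _ (leq_addl a b) hb).
set u := res x _; set v := res y _ => hu hv.
have u0 : (0 < u)%N by case: u hu; rewrite ?dvdn0.
have v0 : (0 < v)%N by case: v hv; rewrite ?dvdn0.
rewrite !pfactor_dvdn // ?muln_gt0 ?u0 // in hu hv *.
rewrite lognM // leqNgt => /negP; apply.
by rewrite -!ltnNge in hu hv; lia.
Qed.
HB.instance Definition _ := GRing.ComUnitRing_isIntegral.Build padic2 padic2_idomain.

End PadicRing.

Definition padic2_mod4 (x : padic2) : 'Z_4 := (res x 2)%:R.

Definition Q2 : fieldType := {fraction padic2}.

Definition Z2_to (K : fieldExtType Q2) : padic2 -> K :=
  fun a => in_alg K (@tofrac padic2 a).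

Section IntegerRing.
Variable K : fieldExtType Q2.

HB.instance Definition _ := GRing.RMorphism.copy (@Z2_to K) (in_alg K \o @tofrac padic2).

Definition int_pred : {pred K} := fun x => `[< integralOver (@Z2_to K) x >].

Fact int_pred_subring : subring_closed int_pred.
Proof.
split; first by apply/asboolP; apply: integral1.
  by move=> x y /asboolP hx /asboolP hy; apply/asboolP; apply: integral_sub.
by move=> x y /asboolP hx /asboolP hy; apply/asboolP; apply: integral_mul.
Qed.
HB.instance Definition _ := GRing.isSubringClosed.Build K int_pred int_pred_subring.

Record int_ring := IntRing { int_val :> K; int_valP : int_val \in int_pred }.
HB.instance Definition _ := [isSub for int_val].
HB.instance Definition _ := [Choice of int_ring by <:].
HB.instance Definition _ := [SubChoice_isSubComNzRing of int_ring by <:].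

(* 2 is a uniformizer: the maximal ideal of [int_ring K] (its non-units) is
   generated by 2. *)
Definition unramified :=
  forall x : int_ring, ~ (exists y, x * y = 1) <-> exists y, x = 2%:R * y.

(* The trace of multiplication by x, as a Q_2-linear endomorphism of K. *)
Definition field_trace (x : K) : Q2 :=
  \sum_(i < \dim {:K}) coord (vbasis {:K}) i (x * (vbasis {:K})`_i).

End IntegerRing.

(* The ring morphism f presents B as the quotient A / aA. *)
Definition quotient_by (A B : nzRingType) (a : A) (f : {rmorphism A -> B}) :=
  (forall b, exists x, f x = b) /\ (forall x, f x = 0 <-> exists y, x = a * y).

(* k = O_K / m_K and R = O_K / m_K^2, with m_K = 2 O_K, are given up to
   isomorphism, by the reduction maps from O_K = int_ring K. *)
Record unramified_ext := UnramifiedExt {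
  ur_field : fieldExtType Q2;
  ur_unramified : unramified ur_field;
  ur_k : finFieldType;
  ur_red1 : {rmorphism int_ring ur_field -> ur_k};
  ur_red1P : quotient_by 2%:R ur_red1;
  ur_R : finComNzRingType;
  ur_red2 : {rmorphism int_ring ur_field -> ur_R};
  ur_red2P : quotient_by (2%:R ^+ 2) ur_red2 }.

Definition ur_degree (A : unramified_ext) : nat := \dim {: ur_field A}.

(* tr : R -> Z/4 is induced by Tr_{K/Q_2}, which maps the integers of K to
   Z_2: if z is the class of x and Tr x = a in Z_2, then tr z = a mod 4. *)
Definition ur_trace (A : unramified_ext) (z : ur_R A) : 'Z_4 :=
  xget 0 [set c | exists (x : int_ring (ur_field A)) (a : padic2),
    [/\ ur_red2 A x = z, field_trace (int_val x) = @tofrac padic2 a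
      & c = padic2_mod4 a]]%classic.

Section Modules.
Variable R : comNzRingType.

Definition submodule (V : lmodType R) (S : set V) :=
  S 0 /\ forall a x y, S x -> S y -> S (a *: x + y).

Definition free_of_rank (V : lmodType R) (S : set V) (r : nat) :=
  submodule S /\ exists2 e : 'I_r -> V, (forall i, S (e i)) &
    forall x, S x -> exists! c : {ffun 'I_r -> R}, x = \sum_i c i *: e i.

(* Alternating bilinear forms with trivial radical; over a finite ring R this
   makes a free module of finite rank isomorphic to its dual. *)
Definition symplectic (V : lmodType R) (om : V -> V -> R) :=
  [/\ forall x, om x x = 0,
      forall a x y z, om (a *: x + y) z = a * om x z + om y z,
      forall a x y z, om z (a *: x + y) = a * om z x + om z y
    & forall x, (forall y, om x y = 0) -> x = 0].

End Modules.

Definition lagrangian (V : Type) (X : zmodType) (om : V -> V -> X) (S : set V) :=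
  forall x, S x <-> forall y, S y -> om x y = 0.

(* A free symplectic module [ss_Vt] of rank 2n with a splitting into free
   Lagrangian submodules, and its reduction [ss_red : ss_Vt -> ss_V] mod 2. *)
Record split_symplectic (A : unramified_ext) (n : nat) := SplitSymplectic {
  ss_Vt : lmodType (ur_R A);
  ss_omt : ss_Vt -> ss_Vt -> ur_R A;
  ss_free : free_of_rank [set: ss_Vt]%classic (2 * n)%N;
  ss_sympl : symplectic ss_omt;
  ss_L0 : set ss_Vt;
  ss_M0 : set ss_Vt;
  ss_L0_lag : lagrangian ss_omt ss_L0;
  ss_M0_lag : lagrangian ss_omt ss_M0;
  ss_L0_free : exists r, free_of_rank ss_L0 r;
  ss_M0_free : exists r, free_of_rank ss_M0 r;
  ss_split : forall x, exists! lm : ss_Vt * ss_Vt,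
    [/\ ss_L0 lm.1, ss_M0 lm.2 & x = lm.1 + lm.2];
  ss_V : finLmodType (ur_k A);
  ss_red : {additive ss_Vt -> ss_V};
  ss_redZ : forall a x, ss_red (ur_red2 A a *: x) = ur_red1 A a *: ss_red x;
  ss_red_surj : forall v, exists x, ss_red x = v;
  ss_redP : forall x, ss_red x = 0 <-> exists y, x = 2%:R *: y }.

Arguments ss_omt {A n} s _ _.
Arguments ss_L0 {A n} s _.
Arguments ss_M0 {A n} s _.

Section Forms.
Variables (A : unramified_ext) (n : nat) (S : split_symplectic A n).
Local Notation R := (ur_R A).
Local Notation Vt := (ss_Vt S).
Local Notation V := (ss_V S).

Definition ss_parts (x : Vt) : Vt * Vt :=
  xget (0, 0) [set lm | [/\ ss_L0 S lm.1, ss_M0 S lm.2 & x = lm.1 + lm.2]]%classic.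

Definition ss_betat (x y : Vt) : R := ss_omt S (ss_parts x).1 (ss_parts y).2.

Definition ss_lift (v : V) : Vt := xget 0 [set x | ss_red S x = v]%classic.

(* The factorizations of 2 * omt and 2 * betat through ss_red; see omegaE and
   betaE. *)
Definition omega (v w : V) : R := 2%:R * ss_omt S (ss_lift v) (ss_lift w).
Definition beta (v w : V) : R := 2%:R * ss_betat (ss_lift v) (ss_lift w).

Lemma ss_liftK v : ss_red S (ss_lift v) = v.
Proof. by rewrite /ss_lift; case: xgetP => //= none; case: (ss_red_surj v) => x /none. Qed.

Lemma ss_partsP x : [/\ ss_L0 S (ss_parts x).1, ss_M0 S (ss_parts x).2
  & x = (ss_parts x).1 + (ss_parts x).2].
Proof.
by rewrite /ss_parts; case: xgetP => //= none; case: (ss_split x) => lm [/none].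
Qed.

Lemma ss_parts_eq x l m : ss_L0 S l -> ss_M0 S m -> x = l + m -> ss_parts x = (l, m).
Proof.
move=> hl hm ex; case: (ss_split x) => lm [_ u].
by rewrite -(u (l, m)) // (u (ss_parts x)) //; apply: ss_partsP.
Qed.

Lemma lag_lin (L : set Vt) : lagrangian (ss_omt S) L ->
  forall a x y, L x -> L y -> L (a *: x + y).
Proof.
case: (ss_sympl S) => _ lin _ _ hL a x y /hL hx /hL hy; apply/hL => z hz.
by rewrite lin hx // hy // mulr0 addr0.
Qed.

Lemma ss_partsL a x y : ss_parts (a *: x + y) =
  (a *: (ss_parts x).1 + (ss_parts y).1, a *: (ss_parts x).2 + (ss_parts y).2).
Proof.
case: (ss_partsP x) (ss_partsP y) => lx mx ex [ly my ey].
apply: ss_parts_eq; first by apply: lag_lin => //; apply: ss_L0_lag.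
  by apply: lag_lin => //; apply: ss_M0_lag.
by rewrite {1}ex {1}ey scalerDr addrACA.
Qed.

Lemma ss_betatLl a x y z : ss_betat (a *: x + y) z = a * ss_betat x z + ss_betat y z.
Proof. by rewrite /ss_betat ss_partsL; case: (ss_sympl S) => _ ->. Qed.

Lemma ss_betatLr a x y z : ss_betat z (a *: x + y) = a * ss_betat z x + ss_betat z y.
Proof. by rewrite /ss_betat ss_partsL; case: (ss_sympl S) => _ _ ->. Qed.

Lemma ur_four : (2%:R * 2%:R : R) = 0.
Proof.
have [_ h] := ur_red2P A; have /h : exists y : int_ring (ur_field A), 2%:R ^+ 2 = 2%:R ^+ 2 * y.
  by exists 1; rewrite mulr1.
by rewrite expr2 rmorphM rmorph_nat.
Qed.

Lemma twice_factor (f : Vt -> Vt -> R) :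
  (forall a x y z, f (a *: x + y) z = a * f x z + f y z) ->
  (forall a x y z, f z (a *: x + y) = a * f z x + f z y) ->
  forall x y, 2%:R * f (ss_lift (ss_red S x)) (ss_lift (ss_red S y)) = 2%:R * f x y.
Proof.
move=> fl fr x y.
have h z : exists t, ss_lift (ss_red S z) = 2%:R *: t + z.
  have /ss_redP[t ht] : ss_red S (ss_lift (ss_red S z) - z) = 0.
    by rewrite raddfB /= ss_liftK subrr.
  by exists t; rewrite -ht subrK.
have [[s ->] [t ->]] := (h x, h y).
by rewrite fl fr !mulrDr !mulrA ur_four !mul0r !add0r fr mulrDr !mulrA ur_four !mul0r ?add0r.
Qed.

Lemma omegaE x y : omega (ss_red S x) (ss_red S y) = 2%:R * ss_omt S x y.
Proof. by case: (ss_sympl S) => _ l r _; apply: twice_factor. Qed.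

Lemma betaE x y : beta (ss_red S x) (ss_red S y) = 2%:R * ss_betat x y.
Proof. exact: twice_factor ss_betatLl ss_betatLr _ _. Qed.

Lemma betaDl u v w : beta (u + v) w = beta u w + beta v w.
Proof.
rewrite -(ss_liftK u) -(ss_liftK v) -(ss_liftK w) -raddfD !betaE.
by rewrite -[X in X + _]scale1r ss_betatLl mul1r mulrDr.
Qed.

Lemma betaDr u v w : beta w (u + v) = beta w u + beta w v.
Proof.
rewrite -(ss_liftK u) -(ss_liftK v) -(ss_liftK w) -raddfD !betaE.
by rewrite -[X in X + _]scale1r ss_betatLr mul1r mulrDr.
Qed.

Lemma omegaDl u v w : omega (u + v) w = omega u w + omega v w.
Proof.
rewrite -(ss_liftK u) -(ss_liftK v) -(ss_liftK w) -raddfD !omegaE.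
by case: (ss_sympl S) => _ lin _ _; rewrite -[X in X + _]scale1r lin mul1r mulrDr.
Qed.

Lemma omega0l v : omega 0 v = 0.
Proof. by apply: (addrI (omega 0 v)); rewrite -omegaDl !addr0. Qed.

Lemma omegaNl u v : omega (- u) v = - omega u v.
Proof. by apply: (addrI (omega u v)); rewrite -omegaDl !subrr omega0l. Qed.

Lemma beta0l v : beta 0 v = 0.
Proof. by apply: (addrI (beta 0 v)); rewrite -betaDl !addr0. Qed.

Lemma beta0r v : beta v 0 = 0.
Proof. by apply: (addrI (beta v 0)); rewrite -betaDr !addr0. Qed.

Lemma betaNl u v : beta (- u) v = - beta u v.
Proof. by apply: (addrI (beta u v)); rewrite -betaDl !subrr beta0l. Qed.

Lemma betaNr u v : beta v (- u) = - beta v u.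
Proof. by apply: (addrI (beta v u)); rewrite -betaDr !subrr beta0r. Qed.

End Forms.

Section Heisenberg.
Variables (A : unramified_ext) (n : nat) (S : split_symplectic A n).
Local Notation R := (ur_R A).
Local Notation V := (ss_V S).

Record heis := Heis { hv : V; hz : R }.

Fact heis_pairK : cancel (fun h => (hv h, hz h)) (fun p => Heis p.1 p.2).
Proof. by case. Qed.
HB.instance Definition _ := Finite.copy heis (can_type heis_pairK).

Definition heis_mul (a b : heis) := Heis (hv a + hv b) (hz a + hz b + beta (hv a) (hv b)).
Definition heis_one := Heis 0 0.
Definition heis_inv (a : heis) := Heis (- hv a) (- hz a + beta (hv a) (hv a)).

Fact heis_mulA : associative heis_mul.
Proof.
move=> [u x] [v y] [w z]; rewrite /heis_mul /= addrA betaDl betaDr.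
by congr Heis; ring.
Qed.
Fact heis_mul1 : left_id heis_one heis_mul.
Proof. by move=> [v z]; rewrite /heis_mul /= beta0l !add0r addr0. Qed.
Fact heis_mulr1 : right_id heis_one heis_mul.
Proof. by move=> [v z]; rewrite /heis_mul /= beta0r !addr0. Qed.
Fact heis_mulV : left_inverse heis_one heis_inv heis_mul.
Proof.
move=> [v z]; rewrite /heis_mul /= betaNl addNr; by congr Heis; ring.
Qed.
Fact heis_mulVr : right_inverse heis_one heis_inv heis_mul.
Proof.
move=> [v z]; rewrite /heis_mul /= betaNr addrN; by congr Heis; ring.
Qed.
HB.instance Definition _ :=
  isGroup.Build heis heis_mulA heis_mul1 heis_mulr1 heis_mulV heis_mulVr.

Definition center (z : R) : heis := Heis 0 z.

Definition is_Sp (g : {perm V}) :=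
  (forall a v w, g (a *: v + w) = a *: g v + g w) /\
  (forall v w, omega (g v) (g w) = omega v w).

Definition Sigma (g : {perm V}) (al : {ffun V -> R}) := forall v1 v2,
  al (v1 + v2) - al v1 - al v2 = beta (g v1) (g v2) - beta v1 v2.

Record ASp := MkASp {
  asp_lin : {perm V};
  asp_fun : {ffun V -> R};
  asp_sp : is_Sp asp_lin;
  asp_sigma : Sigma asp_lin asp_fun }.
HB.instance Definition _ := gen_eqMixin ASp.
HB.instance Definition _ := gen_choiceMixin ASp.

Lemma aspP (g h : ASp) :
  asp_lin g =1 asp_lin h -> asp_fun g =1 asp_fun h -> g = h.
Proof.
case: g h => [g a p q] [h b r s] /= /permP e /ffunP f.
by subst h b; congr MkASp; apply: Prop_irrelevance.
Qed.

Fact asp_mul_sp (g h : ASp) : is_Sp (asp_lin h * asp_lin g)%g.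
Proof.
case: g h => [g a [lg og] _] [h b [lh oh] _] /=; split=> [c v w|v w].
  by rewrite !permM lh lg.
by rewrite !permM og oh.
Qed.
Fact asp_mul_sigma (g h : ASp) : Sigma (asp_lin h * asp_lin g)%g
  [ffun v => asp_fun g (asp_lin h v) + asp_fun h v].
Proof.
case: g h => [g a [lg og] sg] [h b [lh oh] sh] v w /=; rewrite !ffunE !permM.
have hD : h (v + w) = h v + h w by rewrite -[v]scale1r lh !scale1r.
have := sg (h v) (h w); have := sh v w; rewrite -hD => e1 e2.
transitivity ((beta (g (h v)) (g (h w)) - beta (h v) (h w))
  + (beta (h v) (h w) - beta v w)); last by ring.
by rewrite -e1 -e2; ring.
Qed.
(* [(s * t)%g x = t (s x)] in {perm V}: the linear part of g h is v |-> g (h v) *)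
Definition asp_mul (g h : ASp) := MkASp (asp_mul_sp g h) (asp_mul_sigma g h).

Fact asp_one_sp : is_Sp 1%g.
Proof. by split=> *; rewrite !perm1. Qed.
Fact asp_one_sigma : Sigma 1%g [ffun=> 0].
Proof. by move=> v w; rewrite !ffunE !perm1 !subrr. Qed.
Definition asp_one := MkASp asp_one_sp asp_one_sigma.

Fact asp_inv_sp (g : ASp) : is_Sp (asp_lin g)^-1%g.
Proof.
case: g => [g a [lg og] _] /=; split=> [c v w|v w].
  by apply: (@perm_inj _ g); rewrite lg !permKV.
by rewrite -og !permKV.
Qed.
Fact asp_inv_sigma (g : ASp) :
  Sigma (asp_lin g)^-1%g [ffun v => - asp_fun g ((asp_lin g)^-1%g v)].
Proof.
case: g => [g a [lg og] sg] v w /=; rewrite !ffunE.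
have lV : g^-1%g (v + w) = g^-1%g v + g^-1%g w.
  by apply: (@perm_inj _ g); rewrite -[X in X + g^-1%g w]scale1r lg scale1r !permKV.
have := sg (g^-1%g v) (g^-1%g w); rewrite !permKV lV => e.
by rewrite -[RHS]opprB -e; ring.
Qed.
Definition asp_inv (g : ASp) := MkASp (asp_inv_sp g) (asp_inv_sigma g).

Fact asp_mulA : associative asp_mul.
Proof.
move=> g h k; apply: aspP => v /=; first by rewrite !permM.
by rewrite !ffunE permM addrA.
Qed.
Fact asp_mul1 : left_id asp_one asp_mul.
Proof. by move=> g; apply: aspP => v /=; rewrite ?permM ?perm1 // !ffunE add0r. Qed.
Fact asp_mulr1 : right_id asp_one asp_mul.
Proof. by move=> g; apply: aspP => v /=; rewrite ?permM ?perm1 // !ffunE perm1 addr0. Qed.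
Fact asp_mulV : left_inverse asp_one asp_inv asp_mul.
Proof.
move=> g; apply: aspP => v /=; first by rewrite permM permK perm1.
by rewrite !ffunE permK addNr.
Qed.
Fact asp_mulVr : right_inverse asp_one asp_inv asp_mul.
Proof.
move=> g; apply: aspP => v /=; first by rewrite permM permKV perm1.
by rewrite !ffunE addrN.
Qed.
HB.instance Definition _ :=
  isGroup.Build ASp asp_mulA asp_mul1 asp_mulr1 asp_mulV asp_mulVr.

Definition asp_act (g : ASp) (h : heis) : heis :=
  Heis (asp_lin g (hv h)) (hz h + asp_fun g (hv h)).

Lemma asp_actM g h x : asp_act (g * h)%g x = asp_act g (asp_act h x).
Proof. by case: x => v z; rewrite /asp_act /= permM ffunE addrA addrAC -addrA addrCA addrA. Qed.

Lemma asp_act1 x : asp_act 1%g x = x.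
Proof. by case: x => v z; rewrite /asp_act /= perm1 ffunE addr0. Qed.

Lemma asp_actK g : cancel (asp_act g) (asp_act g^-1%g).
Proof. by move=> x; rewrite -asp_actM mulVg asp_act1. Qed.

Lemma asp_actVK g : cancel (asp_act g^-1%g) (asp_act g).
Proof. by move=> x; rewrite -asp_actM mulgV asp_act1. Qed.

Lemma asp_linD (g : ASp) v w : asp_lin g (v + w) = asp_lin g v + asp_lin g w.
Proof. by case: (asp_sp g) => l _; rewrite -[v]scale1r l !scale1r. Qed.

Lemma asp_act_mul g x y : asp_act g (x * y)%g = (asp_act g x * asp_act g y)%g.
Proof.
case: x y => [v z] [w t]; apply/(can_inj heis_pairK); rewrite /= asp_linD; congr pair.
by have := asp_sigma g v w => /eqP; rewrite !subr_eq => /eqP ->; ring.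
Qed.

Lemma asp_act_center g z : asp_act g (center z) = center z.
Proof.
have h0 : asp_lin g 0 = 0 by apply: (addrI (asp_lin g 0)); rewrite -asp_linD !addr0.
rewrite /asp_act /= h0; congr Heis.
have := asp_sigma g 0 0; rewrite h0 subrr addr0 subrr sub0r => /eqP.
by rewrite oppr_eq0 => /eqP ->; rewrite addr0.
Qed.

(* A homomorphic section tau : L -> H(V) over a Lagrangian L, extended by 1
   outside L so that equality of enhanced Lagrangians is equality of L and tau. *)
Record elag := ELag {
  el_sub : {set V};
  el_tau : {ffun V -> heis};
  el_lag : lagrangian (@omega _ _ S) (fun v => v \in el_sub);
  el_sec : {in el_sub, forall l, hv (el_tau l) = l};
  el_hom : {in el_sub &, forall l m, el_tau (l + m) = (el_tau l * el_tau m)%g};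
  el_out : forall v, v \notin el_sub -> el_tau v = 1%g }.

Lemma elagP (L M : elag) : el_sub L = el_sub M -> el_tau L =1 el_tau M -> L = M.
Proof.
case: L M => [L t l1 l2 l3 l4] [M u m1 m2 m3 m4] /= e /ffunP f.
by subst M u; congr ELag; apply: Prop_irrelevance.
Qed.

Section Subspace.
Variable L : elag.

Lemma elag_sub0 : 0 \in el_sub L.
Proof. by apply/el_lag => w _; rewrite omega0l. Qed.

Lemma elag_subD l m : l \in el_sub L -> m \in el_sub L -> l + m \in el_sub L.
Proof. by move=> /el_lag hl /el_lag hm; apply/el_lag => w hw; rewrite omegaDl hl // hm // addr0. Qed.

Lemma elag_subN l : l \in el_sub L -> - l \in el_sub L.
Proof. by move=> /el_lag hl; apply/el_lag => w hw; rewrite omegaNl hl // oppr0. Qed.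

Lemma el_tau0 : el_tau L 0 = 1%g.
Proof. by apply: (mulgI (el_tau L 0)); rewrite -el_hom ?elag_sub0 // addr0 mulg1. Qed.

End Subspace.

Section Action.
Variables (g : ASp) (L : elag).
Definition elag_act_sub := (asp_lin g) @: el_sub L.
Definition elag_act_tau := [ffun v => if v \in elag_act_sub
  then asp_act g (el_tau L ((asp_lin g)^-1%g v)) else 1%g].

Lemma elag_act_subE v : (v \in elag_act_sub) = ((asp_lin g)^-1%g v \in el_sub L).
Proof. by rewrite -{1}[v](permKV (asp_lin g)) mem_imset //; apply: perm_inj. Qed.

Lemma elag_act_tauE v : v \in el_sub L ->
  elag_act_tau (asp_lin g v) = asp_act g (el_tau L v).
Proof. by move=> hv; rewrite ffunE elag_act_subE permK hv. Qed.

Fact elag_act_lag : lagrangian (@omega _ _ S) (fun v => v \in elag_act_sub).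
Proof.
case: (asp_sp g) => _ og v; rewrite elag_act_subE el_lag; split=> h w.
  by rewrite elag_act_subE => /h; rewrite -og !permKV.
by move=> hw; rewrite -og permKV h // elag_act_subE permK.
Qed.
Fact elag_act_sec : {in elag_act_sub, forall l, hv (elag_act_tau l) = l}.
Proof.
by move=> l hl; rewrite ffunE hl /= el_sec ?permKV // -elag_act_subE.
Qed.
Fact elag_act_hom : {in elag_act_sub &,
  forall l m, elag_act_tau (l + m) = (elag_act_tau l * elag_act_tau m)%g}.
Proof.
move=> _ _ /imsetP[l hl ->] /imsetP[m hm ->].
by rewrite -asp_linD !elag_act_tauE ?elag_subD // el_hom // asp_act_mul.
Qed.
Fact elag_act_out v : v \notin elag_act_sub -> elag_act_tau v = 1%g.
Proof. by rewrite ffunE => /negPf ->. Qed.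
Definition elag_act : elag := ELag elag_act_lag elag_act_sec elag_act_hom elag_act_out.

Lemma el_tau_actE v : v \in el_sub L ->
  el_tau elag_act (asp_lin g v) = asp_act g (el_tau L v).
Proof. exact: elag_act_tauE. Qed.
End Action.

Lemma elag_actM g h L : elag_act (g * h)%g L = elag_act g (elag_act h L).
Proof.
have e : elag_act_sub (g * h)%g L = elag_act_sub g (elag_act h L).
  by apply/setP => v; rewrite !elag_act_subE /= invMg permM.
apply: elagP => //= v; rewrite !ffunE e; case: ifP => //.
by rewrite !elag_act_subE /= => hv; rewrite hv asp_actM /= invMg permM.
Qed.

Lemma elag_act1 L : elag_act 1%g L = L.
Proof.
have e : elag_act_sub 1%g L = el_sub L.
  by apply/setP => v; rewrite elag_act_subE /= invg1 perm1.
apply: elagP => //= v; rewrite !ffunE e; case: ifPn => [hv|/el_out ->//].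
by rewrite asp_act1 /= invg1 perm1.
Qed.

Definition general_position (M L : elag) :=
  forall v, exists m l, [/\ m \in el_sub M, l \in el_sub L & v = m + l].

Lemma general_position_act g M L :
  general_position M L -> general_position (elag_act g M) (elag_act g L).
Proof.
move=> h v; have [m [l [hm hl e]]] := h ((asp_lin g)^-1%g v).
exists (asp_lin g m), (asp_lin g l); rewrite !imset_f //; split=> //.
by rewrite -asp_linD -e permKV.
Qed.

Lemma general_position_actV g M L :
  general_position (elag_act g M) (elag_act g L) -> general_position M L.
Proof.
by move=> /(general_position_act g^-1%g); rewrite -!elag_actM mulVg !elag_act1.
Qed.

Lemma card_elag_act g L : #|el_sub (elag_act g L)| = #|el_sub L|.
Proof. by rewrite card_imset //; apply: perm_inj. Qed.

End Heisenberg.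

Section TensorPower.
Variables (F : fieldType) (m : nat).

Definition upd (U : Type) (u : 'I_m -> U) (i : 'I_m) (x : U) : 'I_m -> U :=
  fun j => if j == i then x else u j.

Record mlform (U : lmodType F) := MLForm {
  mlform_fun :> ('I_m -> U) -> F;
  mlformP : forall i u a x y, mlform_fun (upd u i (a *: x + y)) =
    a * mlform_fun (upd u i x) + mlform_fun (upd u i y) }.

(* The m-th tensor power of U over the field F, realized as the span of the pure
   tensors in the dual of the space of m-linear forms on U. The pure tensor
   u_1 (x) ... (x) u_m is the evaluation b |-> b u. *)
Definition tpow_pred (U : lmodType F) : {pred mlform U -> F^o} := fun t =>
  `[< exists s : seq (F * ('I_m -> U)),
        t = (fun b => \sum_(p <- s) p.1 * b p.2) >].

Fact tpow_pred_submod (U : lmodType F) : submod_closed (@tpow_pred U).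
Proof.
split; first by apply/asboolP; exists [::]; apply/funext => b; rewrite big_nil.
move=> a t t' /asboolP[s ->] /asboolP[s' ->]; apply/asboolP.
exists ([seq (a * p.1, p.2) | p <- s] ++ s'); apply/funext => b.
rewrite big_cat big_map; congr (_ + _).
rewrite [LHS]/GRing.scale /= [LHS]mulr_sumr.
by apply: eq_bigr => p _; rewrite mulrA.
Qed.
HB.instance Definition _ (U : lmodType F) :=
  GRing.isSubmodClosed.Build F (mlform U -> F^o) (@tpow_pred U) (@tpow_pred_submod U).

Record tpow (U : lmodType F) := TPow {
  tpow_val :> mlform U -> F^o;
  tpow_valP : tpow_val \in @tpow_pred U }.
HB.instance Definition _ (U : lmodType F) := [isSub for @tpow_val U].
HB.instance Definition _ (U : lmodType F) := [Choice of tpow U by <:].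
HB.instance Definition _ (U : lmodType F) := [SubChoice_isSubLmodule of tpow U by <:].

Lemma tpowP (U : lmodType F) (t t' : tpow U) : (forall b, t b = t' b) -> t = t'.
Proof. by move=> /funext; apply: val_inj. Qed.

Section Functoriality.
Variables (U W : lmodType F) (f : 'I_m -> {linear U -> W}).

Fact mlform_comp_subproof (b : mlform W) i (u : 'I_m -> U) a x y :
  b (fun j => f j (upd u i (a *: x + y) j)) =
  a * b (fun j => f j (upd u i x j)) + b (fun j => f j (upd u i y j)).
Proof.
have e z : (fun j => f j (upd u i z j)) = upd (fun j => f j (u j)) i (f i z).
  by apply/funext => j; rewrite /upd; case: eqP => [->|].
by rewrite !e linearP mlformP.
Qed.
Definition mlform_comp (b : mlform W) : mlform U := 
  @MLForm U (fun u => b (fun j => f j (u j))) (mlform_comp_subproof b).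

Fact tmap_subproof (t : tpow U) : (fun b => t (mlform_comp b)) \in @tpow_pred W.
Proof.
case: t => t /= /asboolP[s ->]; apply/asboolP.
exists [seq (p.1, fun j => f j (p.2 j)) | p <- s].
by apply/funext => b; rewrite big_map.
Qed.
(* f_1 (x) ... (x) f_m *)
Definition tmap (t : tpow U) : tpow W := TPow (tmap_subproof t).

Fact tmap_linear : linear tmap.
Proof. by move=> a t t'; apply: tpowP. Qed.
HB.instance Definition _ := GRing.isLinear.Build F (tpow U) (tpow W) *:%R tmap tmap_linear.
End Functoriality.

Lemma mlform_eq (U : lmodType F) (b c : mlform U) : (forall u, b u = c u) -> b = c.
Proof.
case: b c => [b hb] [c hc] /= /funext e; case: _ / e hc => hc.
by congr MLForm; apply: Prop_irrelevance.
Qed.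

Lemma tmap_comp (U W X : lmodType F) (f : 'I_m -> {linear U -> W})
    (g : 'I_m -> {linear W -> X}) (h : 'I_m -> {linear U -> X}) :
  (forall i x, h i x = g i (f i x)) -> forall t, tmap g (tmap f t) = tmap h t.
Proof.
move=> e t; apply: tpowP => b /=; congr (tpow_val t); apply: mlform_eq => u /=.
by congr (mlform_fun b); apply/funext => j; rewrite e.
Qed.

Lemma tmap_id (U : lmodType F) (f : 'I_m -> {linear U -> U}) :
  (forall i x, f i x = x) -> forall t, tmap f t = t.
Proof.
move=> e t; apply: tpowP => b /=; congr (tpow_val t); apply: mlform_eq => u /=.
by congr (mlform_fun b); apply/funext => j; rewrite e.
Qed.

Lemma tmap_ext (U W : lmodType F) (f g : 'I_m -> {linear U -> W}) :
  (forall i x, f i x = g i x) -> forall t, tmap f t = tmap g t.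
Proof.
move=> e t; apply: tpowP => b /=; congr (tpow_val t); apply: mlform_eq => u /=.
by congr (mlform_fun b); apply/funext => j; rewrite e.
Qed.

Lemma tmap_cancel (U W : lmodType F) (f : 'I_m -> {linear U -> W})
    (g : 'I_m -> {linear W -> U}) :
  (forall i, cancel (f i) (g i)) -> cancel (tmap f) (tmap g).
Proof.
move=> e t; apply: tpowP => b /=; congr (tpow_val t); apply: mlform_eq => u /=.
by congr (mlform_fun b); apply/funext => j; rewrite e.
Qed.

Lemma tmap_square (U W X Y : lmodType F) (f : 'I_m -> {linear U -> W})
    (g : 'I_m -> {linear W -> X}) (f' : 'I_m -> {linear U -> Y})
    (g' : 'I_m -> {linear Y -> X}) :
  (forall i x, g i (f i x) = g' i (f' i x)) ->
  forall t, tmap g (tmap f t) = tmap g' (tmap f' t).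
Proof.
move=> e t; apply: tpowP => b /=; congr (tpow_val t); apply: mlform_eq => u /=.
by congr (mlform_fun b); apply/funext => j; rewrite e.
Qed.

End TensorPower.

Section Bundles.
Variables (Rr : realType) (A : unramified_ext) (n : nat) (S : split_symplectic A n).
Local Notation C := (Rr[i]).
Local Notation elag := (elag S).
Local Notation heis := (heis S).

Record bundle (G : groupType) := Bundle {
  fib :> elag -> lmodType C;
  act : forall L, G -> {linear fib L -> fib L};
  act1 : forall L x, act L 1%g x = x;
  actM : forall L g h x, act L (g * h)%g x = act L g (act L h x) }.

Definition equivariant (G : groupType) (E E' : bundle G) (L M : elag)
    (f : E L -> E' M) :=
  forall g x, f (act E L g x) = act E' M g (f x).

Record trivialization (G : groupType) (E : bundle G) := Trivialization {
  triv :> forall M L, {linear E L -> E M};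
  triv_bij : forall M L, bijective (triv M L);
  triv_eqv : forall M L, equivariant (triv M L);
  triv_comp : forall N M L x, triv N M (triv M L x) = triv N L x }.

Section TensorBundle.
Variables (m : nat) (G : groupType) (E : bundle G).

Definition tens_act L (g : {ffun 'I_m -> G}) :
    {linear tpow m (E L) -> tpow m (E L)} := tmap (fun i => act E L (g i)).
Fact tens_act1 L x : tens_act L 1%g x = x.
Proof. by apply: tmap_id => i y; rewrite ffunE act1. Qed.
Fact tens_actM L g h x : tens_act L (g * h)%g x = tens_act L g (tens_act L h x).
Proof. by apply/esym/tmap_comp => i y; rewrite ffunE actM. Qed.

Definition tens_bundle : bundle {ffun 'I_m -> G} :=
  @Bundle _ (fun L => tpow m (E L)) tens_act tens_act1 tens_actM.
End TensorBundle.

(* e ^ (i t) *)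
Definition expi (t : Rr) : C := Complex (cos t) (sin t).

Definition psi (z : ur_R A) : C := expi (2 * pi / 4 * (ur_trace z : nat)%:R).

Section HFiber.
Variable L : elag.

Definition hfib_pred : {pred {ffun heis -> C^o}} := fun f =>
  `[< forall z l h, l \in el_sub L ->
        f (center S z * el_tau L l * h)%g = psi z * f h >].
Fact hfib_pred_submod : submod_closed hfib_pred.
Proof.
split; first by apply/asboolP => z l h _; rewrite !ffunE mulr0.
move=> a f f' /asboolP hf /asboolP hf'; apply/asboolP => z l h hl.
by rewrite !ffunE hf // hf' // mulrDr; congr (_ + _); rewrite /GRing.scale /= mulrCA.
Qed.
HB.instance Definition _ :=
  GRing.isSubmodClosed.Build C {ffun heis -> C^o} hfib_pred hfib_pred_submod.

Record hfib := HFib {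
  hfib_val :> {ffun heis -> C^o};
  hfib_valP : hfib_val \in hfib_pred }.
HB.instance Definition _ := [isSub for hfib_val].
HB.instance Definition _ := [Choice of hfib by <:].
HB.instance Definition _ := [SubChoice_isSubLmodule of hfib by <:].

Lemma hfibP (f f' : hfib) : (forall h, f h = f' h) -> f = f'.
Proof. by move=> /ffunP; apply: val_inj. Qed.

Lemma hfibE (f : hfib) z h l : l \in el_sub L ->
  f (center S z * el_tau L l * h)%g = psi z * f h.
Proof. by case: f => f /= /asboolP; apply. Qed.

Lemma hfib_linE a (f f' : hfib) h : (a *: f + f') h = a * f h + f' h.
Proof. by rewrite /= !ffunE. Qed.

Fact hfib_act_subproof (g : heis) (f : hfib) : [ffun h => f (h * g)%g] \in hfib_pred.
Proof. by apply/asboolP => z l h hl; rewrite !ffunE -mulgA hfibE. Qed.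
Definition hfib_act g f := HFib (hfib_act_subproof g f).

Fact hfib_act_linear g : linear (hfib_act g).
Proof. by move=> a f f'; apply: hfibP => h; rewrite hfib_linE /= !ffunE. Qed.
HB.instance Definition _ g :=
  GRing.isLinear.Build C hfib hfib *:%R (hfib_act g) (hfib_act_linear g).
End HFiber.

Fact hfib_act1 L f : hfib_act (L := L) 1%g f = f.
Proof. by apply: hfibP => h; rewrite /= ffunE mulg1. Qed.
Fact hfib_actM L g h f :
  hfib_act (L := L) (g * h)%g f = hfib_act g (hfib_act h f).
Proof. by apply: hfibP => x; rewrite /= !ffunE mulgA. Qed.

Definition hbundle : bundle heis :=
  @Bundle _ (fun L => hfib L) (fun L g => @hfib_act L g) hfib_act1 hfib_actM.

Section Intertwiners.
Variables M L : elag.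

Lemma hfib_center (f : hfib L) z h : f (center S z * h)%g = psi z * f h.
Proof.
by rewrite -(hfibE f z h (elag_sub0 L)) el_tau0 mulg1.
Qed.

Fact Fop_subproof (f : hfib L) :
  [ffun h => \sum_(m in el_sub M) f (el_tau M m * h)%g : C^o] \in hfib_pred M.
Proof.
apply/asboolP => z l h hl; rewrite !ffunE mulr_sumr.
have cz x : (x * center S z = center S z * x)%g.
  case: x => v w; rewrite /mulg /= /heis_mul /= beta0l beta0r.
  by rewrite !addr0 add0r addrC.
rewrite [RHS](reindex_onto (fun m => m + l) (fun m => m - l)) /=; last first.
  by move=> m _; rewrite subrK.
apply: eq_big => [m|m hm].
  rewrite addrK eqxx andbT; apply/idP/idP => [hm|hml]; first exact: elag_subD.
  by rewrite -[m](addrK l) elag_subD ?elag_subN.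
by rewrite el_hom // !mulgA cz -!mulgA hfib_center.
Qed.
Definition Fop (f : hfib L) : hfib M := HFib (Fop_subproof f).

Fact Fop_linear : linear Fop.
Proof.
move=> a f f'; apply: hfibP => h; rewrite hfib_linE /= !ffunE mulr_sumr -big_split.
by apply: eq_bigr => m _; rewrite hfib_linE.
Qed.
HB.instance Definition _ := GRing.isLinear.Build C (hfib L) (hfib M) *:%R Fop Fop_linear.
End Intertwiners.

(* T is the unique trivialization of the 4th tensor power of the bundle H which
   is (-1)^(dn) / |M|^2 * F_{M,L}^{(x) 4} for (M, L) in general position. *)
Definition normalized (T : trivialization (tens_bundle 4 hbundle)) :=
  forall M L, general_position M L -> forall x : tpow 4 (hfib L),
    T M L x = ((-1) ^+ (ur_degree A * n)%N / #|el_sub M|%:R ^+ 2)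
                *: tmap (fun _ : 'I_4 => @Fop M L) x.

Record canonical_trivialization := CanonicalTrivialization {
  ctriv :> trivialization (tens_bundle 4 hbundle);
  ctriv_normalized : normalized ctriv;
  ctriv_unique : forall T, normalized T ->
    forall M L x, T M L x = ctriv M L x }.

End Bundles.

Section Trivializations.
Variables (Rr : realType) (A : unramified_ext) (n : nat) (S : split_symplectic A n).
Variables (G : groupType) (E : bundle Rr S G).

Lemma triv_id (t : trivialization E) L x : t L L x = x.
Proof. by apply: (bij_inj (triv_bij t L L)); rewrite triv_comp. Qed.

Section TensorTrivialization.
Variables (m : nat) (t : trivialization E).

Definition tens_triv_fun M L : {linear tpow m (E L) -> tpow m (E M)} :=
  tmap (fun _ => t M L).
Fact tens_triv_comp N M L x :
  tens_triv_fun N M (tens_triv_fun M L x) = tens_triv_fun N L x.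
Proof. by apply: tmap_comp => i y; rewrite triv_comp. Qed.
Fact tens_triv_bij M L : bijective (tens_triv_fun M L).
Proof.
exists (tens_triv_fun L M) => x; rewrite tens_triv_comp;
  by apply: tmap_id => i y; rewrite triv_id.
Qed.
Fact tens_triv_eqv M L :
  equivariant (E := tens_bundle m E) (E' := tens_bundle m E) (tens_triv_fun M L).
Proof.
by move=> g x; apply: tmap_square => i y; apply: triv_eqv.
Qed.
Definition tens_triv : trivialization (tens_bundle m E) :=
  @Trivialization _ _ _ _ _ (tens_bundle m E) _ tens_triv_bij tens_triv_eqv tens_triv_comp.
End TensorTrivialization.

End Trivializations.

Definition triv_morphism (Rr : realType) (A : unramified_ext) (n : nat)
    (S : split_symplectic A n) (G : groupType) (E E' : bundle Rr S G)
    (t : trivialization E) (t' : trivialization E') (f : forall L, E L -> E' L) :=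
  forall M L x, t' M L (f L x) = f M (t M L x).

Section Theta.
Variables (Rr : realType) (A : unramified_ext) (n : nat) (S : split_symplectic A n).
Variables (g : ASp S) (L : elag S).
Local Notation C := (Rr[i]).

Fact theta_subproof (f : hfib Rr (elag_act g L)) :
  [ffun h => f (asp_act g h)] \in hfib_pred L.
Proof.
apply/asboolP => z l h hl; rewrite !ffunE !asp_act_mul asp_act_center.
by rewrite -el_tau_actE // hfibE ?imset_f.
Qed.
Definition theta (f : hfib Rr (elag_act g L)) : hfib Rr L := HFib (theta_subproof f).
Fact theta_linear : linear theta.
Proof. by move=> a f f'; apply: hfibP => h; rewrite hfib_linE /= !ffunE. Qed.
HB.instance Definition _ := GRing.isLinear.Build C _ _ *:%R theta theta_linear.

Fact theta_inv_subproof (f : hfib Rr L) :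
  [ffun h => f (asp_act g^-1%g h)] \in hfib_pred (elag_act g L).
Proof.
apply/asboolP => z _ h /imsetP[l hl ->]; rewrite [LHS]ffunE [X in _ = _ * X]ffunE !asp_act_mul asp_act_center.
by rewrite el_tau_actE // asp_actK hfibE.
Qed.
Definition theta_inv (f : hfib Rr L) : hfib Rr (elag_act g L) :=
  HFib (theta_inv_subproof f).
Fact theta_inv_linear : linear theta_inv.
Proof. by move=> a f f'; apply: hfibP => h; rewrite hfib_linE /= !ffunE. Qed.
HB.instance Definition _ := GRing.isLinear.Build C _ _ *:%R theta_inv theta_inv_linear.

Lemma thetaK : cancel theta theta_inv.
Proof. by move=> f; apply: hfibP => h; rewrite /= !ffunE asp_actVK. Qed.
Lemma theta_invK : cancel theta_inv theta.
Proof. by move=> f; apply: hfibP => h; rewrite /= !ffunE asp_actK. Qed.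

Lemma theta_act x f : theta (hfib_act (asp_act g x) f) = hfib_act x (theta f).
Proof. by apply: hfibP => h; rewrite /= !ffunE asp_act_mul. Qed.
End Theta.

Section ThetaTensor.
Variables (Rr : realType) (A : unramified_ext) (n : nat) (S : split_symplectic A n).
Variables (T : canonical_trivialization Rr S) (g : ASp S).
Local Notation C := (Rr[i]).
Local Notation tens L := (tpow 4 (hfib Rr L)).

Definition theta4 (L : elag S) : {linear tens (elag_act g L) -> tens L} :=
  tmap (fun _ : 'I_4 => @theta Rr A n S g L).
Definition theta4_inv (L : elag S) : {linear tens L -> tens (elag_act g L)} :=
  tmap (fun _ : 'I_4 => @theta_inv Rr A n S g L).

Lemma theta4K L : cancel (theta4 L) (theta4_inv L).
Proof. by apply: tmap_cancel => i; apply: thetaK. Qed.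
Lemma theta4_invK L : cancel (theta4_inv L) (theta4 L).
Proof. by apply: tmap_cancel => i; apply: theta_invK. Qed.

Lemma Fop_theta M L (f : hfib Rr (elag_act g L)) :
  Fop M (theta f) = @theta Rr A n S g M (Fop (elag_act g M) f) :> hfib Rr M.
Proof.
apply: hfibP => h; rewrite /= !ffunE big_imset /=; last by move=> x y _ _ /perm_inj.
apply: eq_bigr => m hm; by rewrite ffunE asp_act_mul -el_tau_actE.
Qed.

Lemma theta4_act L (x : {ffun 'I_4 -> heis S}) t :
  theta4 L (act (tens_bundle 4 (hbundle Rr S)) _ [ffun i => asp_act g (x i)] t) =
  act (tens_bundle 4 (hbundle Rr S)) L x (theta4 L t).
Proof.
by apply: tmap_square => i y; rewrite ffunE; apply: theta_act.
Qed.

Definition conj_triv_fun (M L : elag S) : {linear tens L -> tens M} :=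
  theta4 M \o (ctriv T (elag_act g M) (elag_act g L) \o theta4_inv L).
Fact conj_triv_bij M L : bijective (conj_triv_fun M L).
Proof.
have [t k1 k2] := triv_bij (ctriv T) (elag_act g M) (elag_act g L).
exists (theta4 L \o (t \o theta4_inv M)) => x; rewrite /conj_triv_fun /=.
  by rewrite theta4K k1 theta4_invK.
by rewrite theta4K k2 theta4_invK.
Qed.
Fact conj_triv_eqv M L :
  equivariant (E := tens_bundle 4 (hbundle Rr S)) (E' := tens_bundle 4 (hbundle Rr S))
    (conj_triv_fun M L).
Proof.
move=> x t.
transitivity (theta4 M (T (elag_act g M) (elag_act g L) (act (tens_bundle 4 (hbundle Rr S)) _
    [ffun i => asp_act g (x i)] (theta4_inv L t)))).
  congr (theta4 M (T _ _ _)); apply: (can_inj (@theta4K L)).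
  by rewrite theta4_act !theta4_invK.
by rewrite triv_eqv theta4_act.
Qed.
Fact conj_triv_comp N M L x :
  conj_triv_fun N M (conj_triv_fun M L x) = conj_triv_fun N L x.
Proof. by rewrite /conj_triv_fun /= theta4K triv_comp. Qed.
Definition conj_triv : trivialization (tens_bundle 4 (hbundle Rr S)) :=
  @Trivialization _ _ _ _ _ (tens_bundle 4 (hbundle Rr S)) _ conj_triv_bij conj_triv_eqv conj_triv_comp.

Lemma conj_triv_normalized : normalized conj_triv.
Proof.
move=> M L hML x; rewrite /= ctriv_normalized; last exact: general_position_act.
rewrite card_elag_act linearZ; congr (_ *: _).
transitivity (theta4 M (theta4_inv M (tmap (fun _ => @Fop Rr A n S M L) x))).
  congr (theta4 M _); apply: tmap_square => i y /=.
  by apply: (can_inj (@thetaK Rr A n S g M)); rewrite -Fop_theta !theta_invK.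
exact: theta4_invK.
Qed.

Lemma theta4_triv : forall M L x,
  ctriv T M L (theta4 L x) = theta4 M (ctriv T (elag_act g M) (elag_act g L) x).
Proof.
by move=> M L x; rewrite -(ctriv_unique T conj_triv_normalized) /= theta4K.
Qed.
End ThetaTensor.

Section WeilGerbe.
Variables (Rr : realType) (A : unramified_ext) (n : nat) (S : split_symplectic A n).
Variable T : canonical_trivialization Rr S.
Local Notation C := (Rr[i]).
Local Notation H := (hbundle Rr S).

Record weil_obj := WeilObj {
  w_bundle :> bundle Rr S (heis S);
  w_triv : trivialization w_bundle;
  w_phi : forall L, {linear w_bundle L -> H L};
  w_phi_bij : forall L, bijective (w_phi L);
  w_phi_eqv : forall L, equivariant (w_phi L);
  w_phi_tens : triv_morphism (tens_triv 4 w_triv) T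
    (fun L => tmap (fun _ : 'I_4 => w_phi L)) }.

Record weil_hom (E1 E2 : weil_obj) := WeilHom {
  wh_fun :> forall L, {linear E1 L -> E2 L};
  wh_eqv : forall L, equivariant (wh_fun L);
  wh_triv : triv_morphism (w_triv E1) (w_triv E2) wh_fun;
  wh_phi : forall L x,
    tmap (fun _ : 'I_4 => w_phi E2 L) (tmap (fun _ : 'I_4 => wh_fun L) x) =
    tmap (fun _ : 'I_4 => w_phi E1 L) x }.

Lemma weil_homP E1 E2 (f g : weil_hom E1 E2) : (forall L x, f L x = g L x) -> f = g.
Proof.
have lineq (U W : lmodType C) (a b : {linear U -> W}) : (forall x, a x = b x) -> a = b.
  case: a b => [a ha] [b hb] /= /funext e; subst b; congr GRing.Linear.Pack.
  case: ha hb => [[x1] [x2]] [[y1] [y2]].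
  by rewrite (Prop_irrelevance x1 y1) (Prop_irrelevance x2 y2).
case: f g => [f f1 f2 f3] [g g1 g2 g3] /= e.
have fg : f = g by apply: functional_extensionality_dep => L; apply: lineq => x; apply: e.
by subst g; congr WeilHom; apply: Prop_irrelevance.
Qed.

Section Composition.
Fact weil_id_eqv (E : weil_obj) L : equivariant (E := E) (E' := E) (fun x : E L => idfun x).
Proof. by []. Qed.
Fact weil_id_triv (E : weil_obj) : triv_morphism (w_triv E) (w_triv E) (fun L x => idfun x).
Proof. by []. Qed.
Fact weil_id_phi (E : weil_obj) L x :
  tmap (fun _ : 'I_4 => w_phi E L) (tmap (fun _ : 'I_4 => (idfun : {linear E L -> E L})) x) =
  tmap (fun _ : 'I_4 => w_phi E L) x.
Proof. by apply: tmap_comp. Qed.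
Definition weil_id (E : weil_obj) : weil_hom E E :=
  @WeilHom E E (fun L => idfun) (@weil_id_eqv E) (@weil_id_triv E) (@weil_id_phi E).

Variables (E1 E2 E3 : weil_obj) (g : weil_hom E2 E3) (f : weil_hom E1 E2).
Definition weil_comp_fun L : {linear E1 L -> E3 L} := g L \o f L.
Fact weil_comp_eqv L : equivariant (weil_comp_fun L).
Proof. by move=> h x; rewrite /weil_comp_fun /= !wh_eqv. Qed.
Fact weil_comp_triv : triv_morphism (w_triv E1) (w_triv E3) weil_comp_fun.
Proof. by move=> M L x; rewrite /weil_comp_fun /= !wh_triv. Qed.
Fact weil_comp_phi L x :
  tmap (fun _ : 'I_4 => w_phi E3 L) (tmap (fun _ : 'I_4 => weil_comp_fun L) x) =
  tmap (fun _ : 'I_4 => w_phi E1 L) x.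
Proof.
rewrite -(wh_phi f) -(wh_phi g); congr (tmap _ _).
by apply/esym/tmap_comp.
Qed.
Definition weil_comp : weil_hom E1 E3 := WeilHom weil_comp_eqv weil_comp_triv weil_comp_phi.
End Composition.

Section Pullback.
Variable g : ASp S.

Section PullbackObject.
Variable E : weil_obj.

Definition pull_act L (h : heis S) : {linear E (elag_act g L) -> E (elag_act g L)} :=
  act E (elag_act g L) (asp_act g h).
Fact pull_act1 L x : pull_act L 1%g x = x.
Proof.
have e : asp_act g 1%g = 1%g.
  by apply: (mulgI (asp_act g 1%g)); rewrite -asp_act_mul !mulg1.
by rewrite /pull_act e act1.
Qed.
Fact pull_actM L h k x : pull_act L (h * k)%g x = pull_act L h (pull_act L k x).
Proof. by rewrite /pull_act asp_act_mul actM. Qed.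
Definition pull_bundle : bundle Rr S (heis S) :=
  @Bundle _ _ _ _ _ (fun L => E (elag_act g L)) pull_act pull_act1 pull_actM.

Definition pull_triv_fun M L : {linear pull_bundle L -> pull_bundle M} :=
  w_triv E (elag_act g M) (elag_act g L).
Fact pull_triv_bij M L : bijective (pull_triv_fun M L).
Proof. exact: (triv_bij (w_triv E)). Qed.
Fact pull_triv_eqv M L : equivariant (pull_triv_fun M L).
Proof. by move=> h x; apply: (triv_eqv (w_triv E)). Qed.
Fact pull_triv_comp N M L x :
  pull_triv_fun N M (pull_triv_fun M L x) = pull_triv_fun N L x.
Proof. exact: (triv_comp (w_triv E)). Qed.
Definition pull_triv : trivialization pull_bundle :=
  Trivialization pull_triv_bij pull_triv_eqv pull_triv_comp.

Definition pull_phi L : {linear pull_bundle L -> H L} :=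
  @theta Rr A n S g L \o w_phi E (elag_act g L).
Fact pull_phi_bij L : bijective (pull_phi L).
Proof.
have [t k1 k2] := w_phi_bij E (elag_act g L).
exists (t \o @theta_inv Rr A n S g L) => x; rewrite /pull_phi /=.
  by rewrite thetaK k1.
by rewrite k2 theta_invK.
Qed.
Fact pull_phi_eqv L : equivariant (E' := H) (pull_phi L).
Proof. by move=> h x; rewrite /pull_phi /= w_phi_eqv; apply: theta_act. Qed.
Fact pull_phi_tens : triv_morphism (tens_triv 4 pull_triv) T
  (fun L => tmap (fun _ : 'I_4 => pull_phi L)).
Proof.
have e L x : tmap (fun _ : 'I_4 => pull_phi L) x =
    theta4 _ g L (tmap (fun _ : 'I_4 => w_phi E (elag_act g L)) x).
  by apply/esym/tmap_comp.
move=> M L x; rewrite !e theta4_triv; congr (theta4 _ _ _ _).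
exact: w_phi_tens.
Qed.
Definition pull : weil_obj :=
  @WeilObj pull_bundle pull_triv pull_phi pull_phi_bij pull_phi_eqv pull_phi_tens.
End PullbackObject.

Section PullbackMorphism.
Variables (E1 E2 : weil_obj) (f : weil_hom E1 E2).
Definition pull_hom_fun L : {linear pull E1 L -> pull E2 L} := f (elag_act g L).
Fact pull_hom_eqv L : equivariant (pull_hom_fun L).
Proof. by move=> h x; apply: (@wh_eqv _ _ f _ (asp_act g h) x). Qed.
Fact pull_hom_triv : triv_morphism (w_triv (pull E1)) (w_triv (pull E2)) pull_hom_fun.
Proof. by move=> M L x; apply: (@wh_triv _ _ f (elag_act g M) (elag_act g L) x). Qed.
Fact pull_hom_phi L x :
  tmap (fun _ : 'I_4 => w_phi (pull E2) L) (tmap (fun _ : 'I_4 => pull_hom_fun L) x) =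
  tmap (fun _ : 'I_4 => w_phi (pull E1) L) x.
Proof.
have e E y : tmap (fun _ : 'I_4 => w_phi (pull E) L) y =
    theta4 _ g L (tmap (fun _ : 'I_4 => w_phi E (elag_act g L)) y).
  by apply/esym/tmap_comp.
by rewrite !e; congr (theta4 _ _ _ _); apply: (wh_phi f).
Qed.
Definition pull_hom : weil_hom (pull E1) (pull E2) :=
  WeilHom pull_hom_eqv pull_hom_triv pull_hom_phi.
End PullbackMorphism.
End Pullback.

(* The elements g(hL) and (gh)L of ELag(V) are equal, but the fibers of E over
   them are different types. fib_cast is the identity of the fibers over equal
   points; it makes sense of the equalities of functors (g h)^* = h^* g^* and
   1^* = Id, which are pullM and pull1 below. *)
Definition fib_cast (E : weil_obj) (L M : elag S) (e : L = M) : {linear E L -> E M} :=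
  match e in _ = M return {linear E L -> E M} with erefl => idfun end.

Lemma fib_cast_id (E : weil_obj) L (e : L = L) x : fib_cast E e x = x.
Proof. by rewrite (Prop_irrelevance e erefl). Qed.

Lemma fib_cast_cast (E : weil_obj) L M N (e : L = M) (f : M = N) (h : L = N) x :
  fib_cast E f (fib_cast E e x) = fib_cast E h x.
Proof. by subst; rewrite !fib_cast_id. Qed.

Lemma fib_cast_triv (E : weil_obj) L L' M M' (eL : L = L') (eM : M = M') x :
  w_triv E M' L' (fib_cast E eL x) = fib_cast E eM (w_triv E M L x).
Proof. by subst. Qed.

Lemma fib_cast_phi (E : weil_obj) L M (e : L = M) x h :
  hfib_val (w_phi E M (fib_cast E e x)) h = hfib_val (w_phi E L x) h.
Proof. by subst. Qed.

Lemma fib_cast_nat (E1 E2 : weil_obj) (f : forall L, {linear E1 L -> E2 L})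
    L M (e : L = M) x : f M (fib_cast E1 e x) = fib_cast E2 e (f L x).
Proof. by subst. Qed.

Section HomOfPhi.
Variables (E1 E2 : weil_obj) (f : forall L, {linear E1 L -> E2 L}).
Hypothesis f_triv : triv_morphism (w_triv E1) (w_triv E2) f.
Hypothesis f_phi : forall L x, w_phi E2 L (f L x) = w_phi E1 L x.

Fact hom_of_phi_eqv L : equivariant (f L).
Proof.
move=> h x; apply: (bij_inj (w_phi_bij E2 L)).
by rewrite f_phi !w_phi_eqv f_phi.
Qed.
Fact hom_of_phi_phi L x :
  tmap (fun _ : 'I_4 => w_phi E2 L) (tmap (fun _ : 'I_4 => f L) x) =
  tmap (fun _ : 'I_4 => w_phi E1 L) x.
Proof. by apply: tmap_comp => i y; rewrite f_phi. Qed.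
Definition hom_of_phi : weil_hom E1 E2 := WeilHom hom_of_phi_eqv f_triv hom_of_phi_phi.
End HomOfPhi.

Section PullM.
Variables (g h : ASp S) (E : weil_obj).
Local Notation E1 := (pull (g * h)%g E).
Local Notation E2 := (pull h (pull g E)).
Definition pullM_fun L : {linear E1 L -> E2 L} := fib_cast E (elag_actM g h L).
Fact pullM_triv : triv_morphism (w_triv E1) (w_triv E2) pullM_fun.
Proof. by move=> M L x; exact: (@fib_cast_triv E _ _ _ _ (elag_actM g h L) (elag_actM g h M) x). Qed.
Fact pullM_phi L x : w_phi E2 L (pullM_fun L x) = w_phi E1 L x.
Proof. by apply: hfibP => k; rewrite /= !ffunE fib_cast_phi asp_actM. Qed.
Definition pullM : weil_hom E1 E2 := hom_of_phi pullM_triv pullM_phi.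
End PullM.

Section Pull1.
Variable E : weil_obj.
Definition pull1_fun L : {linear pull 1%g E L -> E L} := fib_cast E (elag_act1 L).
Fact pull1_triv : triv_morphism (w_triv (pull 1%g E)) (w_triv E) pull1_fun.
Proof. by move=> M L x; exact: (@fib_cast_triv E _ _ _ _ (elag_act1 L) (elag_act1 M) x). Qed.
Fact pull1_phi L x : w_phi E L (pull1_fun L x) = w_phi (pull 1%g E) L x.
Proof. by apply: hfibP => k; rewrite /= !ffunE fib_cast_phi asp_act1. Qed.
Definition pull1 : weil_hom (pull 1%g E) E := hom_of_phi pull1_triv pull1_phi.

Definition pull1V_fun L : {linear E L -> pull 1%g E L} := fib_cast E (esym (elag_act1 L)).
Fact pull1V_triv : triv_morphism (w_triv E) (w_triv (pull 1%g E)) pull1V_fun.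
Proof. by move=> M L x; exact: (@fib_cast_triv E _ _ _ _ (esym (elag_act1 L)) (esym (elag_act1 M)) x). Qed.
Fact pull1V_phi L x : w_phi (pull 1%g E) L (pull1V_fun L x) = w_phi E L x.
Proof. by apply: hfibP => k; rewrite /= !ffunE fib_cast_phi asp_act1. Qed.
Definition pull1V : weil_hom E (pull 1%g E) := hom_of_phi pull1V_triv pull1V_phi.
End Pull1.

Section PullV.
Variables (g : ASp S) (E : weil_obj).
Local Notation E1 := (pull g^-1%g (pull g E)).
Fact elag_actVK L : elag_act g (elag_act g^-1%g L) = L.
Proof. by rewrite -elag_actM mulgV elag_act1. Qed.
Definition pullV_fun L : {linear E1 L -> E L} := fib_cast E (elag_actVK L).
Fact pullV_triv : triv_morphism (w_triv E1) (w_triv E) pullV_fun.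
Proof. by move=> M L x; exact: (@fib_cast_triv E _ _ _ _ (elag_actVK L) (elag_actVK M) x). Qed.
Fact pullV_phi L x : w_phi E L (pullV_fun L x) = w_phi E1 L x.
Proof. by apply: hfibP => k; rewrite /= !ffunE fib_cast_phi asp_actVK. Qed.
Definition pullV : weil_hom E1 E := hom_of_phi pullV_triv pullV_phi.

Definition pullVV_fun L : {linear E L -> E1 L} := fib_cast E (esym (elag_actVK L)).
Fact pullVV_triv : triv_morphism (w_triv E) (w_triv E1) pullVV_fun.
Proof. by move=> M L x; exact: (@fib_cast_triv E _ _ _ _ (esym (elag_actVK L)) (esym (elag_actVK M)) x). Qed.
Fact pullVV_phi L x : w_phi E1 L (pullVV_fun L x) = w_phi E L x.
Proof. by apply: hfibP => k; rewrite /= !ffunE fib_cast_phi asp_actVK. Qed.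
Definition pullVV : weil_hom E E1 := hom_of_phi pullVV_triv pullVV_phi.
End PullV.

Section PullMV.
Variables (g h : ASp S) (E : weil_obj).
Local Notation E1 := (pull (g * h)%g E).
Local Notation E2 := (pull h (pull g E)).
Definition pullMV_fun L : {linear E2 L -> E1 L} := fib_cast E (esym (elag_actM g h L)).
Fact pullMV_triv : triv_morphism (w_triv E2) (w_triv E1) pullMV_fun.
Proof. by move=> M L x; exact: (@fib_cast_triv E _ _ _ _ (esym (elag_actM g h L)) (esym (elag_actM g h M)) x). Qed.
Fact pullMV_phi L x : w_phi E1 L (pullMV_fun L x) = w_phi E2 L x.
Proof. by apply: hfibP => k; rewrite /= !ffunE fib_cast_phi asp_actM. Qed.
Definition pullMV : weil_hom E2 E1 := hom_of_phi pullMV_triv pullMV_phi.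
End PullMV.

Definition weil_iso (E1 E2 : weil_obj) (f : weil_hom E1 E2) :=
  exists f' : weil_hom E2 E1, weil_comp f' f = weil_id E1 /\ weil_comp f f' = weil_id E2.

Lemma weil_isoP (E1 E2 : weil_obj) (f : weil_hom E1 E2) (f' : weil_hom E2 E1) :
  (forall L, cancel (f L) (f' L)) -> (forall L, cancel (f' L) (f L)) -> weil_iso f.
Proof. by move=> k1 k2; exists f'; split; apply: weil_homP => L x /=; rewrite ?k1 ?k2. Qed.

Lemma weil_iso_can (E1 E2 : weil_obj) (f : weil_hom E1 E2) : weil_iso f ->
  exists f' : weil_hom E2 E1, forall L, cancel (f L) (f' L) /\ cancel (f' L) (f L).
Proof.
move=> [f' [k1 k2]]; exists f' => L; split=> x.
  by have := congr1 (fun a : weil_hom _ _ => a L x) k1.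
by have := congr1 (fun a : weil_hom _ _ => a L x) k2.
Qed.

(* Isomorphisms of functors g^* -> Id on the category of weil_obj, weil_hom *)
Record pull_iso (g : ASp S) := PullIso {
  pi_fun :> forall E, weil_hom (pull g E) E;
  pi_nat : forall E1 E2 (f : weil_hom E1 E2),
    weil_comp (pi_fun E2) (pull_hom g f) = weil_comp f (pi_fun E1);
  pi_iso : forall E, weil_iso (pi_fun E) }.

Lemma pi_natE g (i : pull_iso g) E1 E2 (f : weil_hom E1 E2) L x :
  i E2 L (f (elag_act g L) x) = f L (i E1 L x).
Proof. exact: (congr1 (fun a : weil_hom (pull g E1) E2 => a L x) (pi_nat i f)). Qed.

Record AMp := MkAMp { amp_g : ASp S; amp_iota : pull_iso amp_g }.

Lemma ampP (a b : AMp) (e : amp_g a = amp_g b) :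
  (forall E L x, amp_iota a E L x =
     amp_iota b E L (fib_cast E (congr1 (fun g => elag_act g L) e) x)) -> a = b.
Proof.
case: a b e => [g i] [h j] /= e; subst h => hij; congr MkAMp.
case: i j hij => [i i1 i2] [j j1 j2] /= hij.
have ij : i = j.
  by apply: functional_extensionality_dep => E; apply: weil_homP => L x; rewrite hij ?fib_cast_id.
by subst j; congr PullIso; apply: Prop_irrelevance.
Qed.

Section Mul.
Variables a b : AMp.
Local Notation g := (amp_g a).
Local Notation h := (amp_g b).

(* iota_h \o h^*(iota_g) : (g h)^* = h^* g^* -> h^* -> Id *)
Definition amp_mul_fun E : weil_hom (pull (g * h)%g E) E :=
  weil_comp (amp_iota b E) (weil_comp (pull_hom h (amp_iota a E)) (pullM g h E)).
Fact amp_mul_nat E1 E2 (f : weil_hom E1 E2) :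
  weil_comp (amp_mul_fun E2) (pull_hom (g * h)%g f) = weil_comp f (amp_mul_fun E1).
Proof.
apply: weil_homP => L x /=; rewrite /weil_comp_fun /= /pull_hom_fun /pullM_fun /=.
by rewrite -(fib_cast_nat f) !pi_natE.
Qed.
Fact amp_mul_iso E : weil_iso (amp_mul_fun E).
Proof.
have [i' hi] := weil_iso_can (pi_iso (amp_iota a) E).
have [j' hj] := weil_iso_can (pi_iso (amp_iota b) E).
apply: (@weil_isoP _ _ _ (weil_comp (pullMV g h E) (weil_comp (pull_hom h i') j'))) => L x /=;
  rewrite /weil_comp_fun /= /pull_hom_fun /= /pullM_fun /pullMV_fun /=.
  by rewrite (hj _).1 (hi _).1 (@fib_cast_cast E _ _ _ _ _ erefl).
by rewrite (@fib_cast_cast E _ _ _ _ _ erefl) /= (hi _).2 (hj _).2.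
Qed.
Definition amp_mul : AMp := MkAMp (PullIso amp_mul_nat amp_mul_iso).
End Mul.

Fact amp_one_nat E1 E2 (f : weil_hom E1 E2) :
  weil_comp (pull1 E2) (pull_hom 1%g f) = weil_comp f (pull1 E1).
Proof.
apply: weil_homP => L x /=; rewrite /weil_comp_fun /= /pull_hom_fun /pull1_fun /=.
by rewrite -(fib_cast_nat f).
Qed.
Fact amp_one_iso E : weil_iso (pull1 E).
Proof.
apply: (@weil_isoP _ _ _ (pull1V E)) => L x /=; exact: (@fib_cast_cast E _ _ _ _ _ erefl).
Qed.
Definition amp_one : AMp := MkAMp (PullIso amp_one_nat amp_one_iso).

Section Inv.
Variable a : AMp.
Local Notation g := (amp_g a).

Definition amp_iotaV E : weil_hom E (pull g E) :=
  sval (cid (weil_iso_can (pi_iso (amp_iota a) E))).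
Lemma amp_iotaK E L : cancel (amp_iota a E L) (amp_iotaV E L).
Proof. by rewrite /amp_iotaV; case: cid => f /= /(_ L)[]. Qed.
Lemma amp_iotaVK E L : cancel (amp_iotaV E L) (amp_iota a E L).
Proof. by rewrite /amp_iotaV; case: cid => f /= /(_ L)[]. Qed.

Definition amp_inv_fun E : weil_hom (pull g^-1%g E) E :=
  weil_comp (pullV g E) (pull_hom g^-1%g (amp_iotaV E)).
Fact amp_inv_nat E1 E2 (f : weil_hom E1 E2) :
  weil_comp (amp_inv_fun E2) (pull_hom g^-1%g f) = weil_comp f (amp_inv_fun E1).
Proof.
apply: weil_homP => L x /=; rewrite /weil_comp_fun /= /pull_hom_fun /pullV_fun /=.
rewrite (fib_cast_nat f); congr (fib_cast _ _ _).
by apply: (can_inj (@amp_iotaK _ _)); rewrite pi_natE !amp_iotaVK.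
Qed.
Fact amp_inv_iso E : weil_iso (amp_inv_fun E).
Proof.
apply: (@weil_isoP _ _ _ (weil_comp (pull_hom g^-1%g (amp_iota a E)) (pullVV g E))) => L x /=;
  rewrite /weil_comp_fun /= /pull_hom_fun /= /pullV_fun /pullVV_fun /=.
  by rewrite (@fib_cast_cast E _ _ _ _ _ erefl) /= amp_iotaVK.
by rewrite amp_iotaK (@fib_cast_cast E _ _ _ _ _ erefl).
Qed.
Definition amp_inv : AMp := MkAMp (PullIso amp_inv_nat amp_inv_iso).
End Inv.

End WeilGerbe.

(* Groups with an arbitrary carrier. The carrier of AMp(V) quantifies over all
   complex vector spaces, and is for this reason too large (in the sense of
   universes) to be a [groupType]. *)
Record grp := Grp {
  grp_sort :> Type;
  grp_mul : grp_sort -> grp_sort -> grp_sort;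
  grp_one : grp_sort;
  grp_inv : grp_sort -> grp_sort;
  grp_mulA : associative grp_mul;
  grp_mul1 : left_id grp_one grp_mul;
  grp_mulr1 : right_id grp_one grp_mul;
  grp_mulV : left_inverse grp_one grp_inv grp_mul;
  grp_mulVr : right_inverse grp_one grp_inv grp_mul }.

Definition grp_of (G : groupType) : grp :=
  Grp (@mulgA G) (@mul1g G) (@mulg1 G) (@mulVg G) (@mulgV G).

Section AMpGroup.
Variables (Rr : realType) (A : unramified_ext) (n : nat) (S : split_symplectic A n).
Variable T : canonical_trivialization Rr S.
Local Notation AMp := (AMp T).
Implicit Types a b c : AMp.

Lemma amp_mulE a b E L x : amp_iota (amp_mul a b) E L x =
  amp_iota b E L (amp_iota a E (elag_act (amp_g b) L)
    (fib_cast E (elag_actM (amp_g a) (amp_g b) L) x)).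
Proof. by []. Qed.

Lemma amp_invE a E L x : amp_iota (amp_inv a) E L x =
  fib_cast E (elag_actVK (amp_g a) L) (amp_iotaV a E (elag_act (amp_g a)^-1%g L) x).
Proof. by []. Qed.

Lemma amp_iota_cast a E L M (e : L = M)
    (f : elag_act (amp_g a) L = elag_act (amp_g a) M) x :
  amp_iota a E M (fib_cast E f x) = fib_cast E e (amp_iota a E L x).
Proof. by subst; rewrite !fib_cast_id. Qed.

Fact amp_mulA : associative (@amp_mul _ _ _ _ T).
Proof.
move=> a b c.
apply: (@ampP _ _ _ _ _ (amp_mul a (amp_mul b c)) (amp_mul (amp_mul a b) c)
  (mulgA (amp_g a) (amp_g b) (amp_g c))) => E L x.
rewrite !amp_mulE -(amp_iota_cast _ (congr1 (elag_act (amp_g a)) (elag_actM (amp_g b) (amp_g c) L))).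
congr (amp_iota c E L (amp_iota b E _ (amp_iota a E _ _))).
have e : elag_act (amp_g a * (amp_g b * amp_g c))%g L =
  elag_act (amp_g a) (elag_act (amp_g b) (elag_act (amp_g c) L)) by rewrite !elag_actM.
have e' : elag_act (amp_g a * amp_g b * amp_g c)%g L =
  elag_act (amp_g a) (elag_act (amp_g b) (elag_act (amp_g c) L)) by rewrite !elag_actM.
rewrite (@fib_cast_cast _ _ _ _ T E _ _ _ _ _ e).
rewrite (@fib_cast_cast _ _ _ _ T E _ _ _ _ _ e').
by rewrite (@fib_cast_cast _ _ _ _ T E _ _ _ _ _ e).
Qed.

Fact amp_mul1 : left_id (amp_one T) (@amp_mul _ _ _ _ T).
Proof.
move=> a; apply: (@ampP _ _ _ _ _ (amp_mul (amp_one T) a) a (mul1g (amp_g a))) => E L x.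
rewrite amp_mulE; congr (amp_iota a E L _).
exact: (@fib_cast_cast _ _ _ _ T E).
Qed.
Fact amp_mulr1 : right_id (amp_one T) (@amp_mul _ _ _ _ T).
Proof.
move=> a; apply: (@ampP _ _ _ _ _ (amp_mul a (amp_one T)) a (mulg1 (amp_g a))) => E L x.
rewrite amp_mulE -[LHS]/(fib_cast E (elag_act1 L) _).
rewrite -(amp_iota_cast _ (congr1 (elag_act (amp_g a)) (elag_act1 L))).
by congr (amp_iota a E L _); apply: (@fib_cast_cast _ _ _ _ T E).
Qed.
Fact amp_mulV : left_inverse (amp_one T) (@amp_inv _ _ _ _ T) (@amp_mul _ _ _ _ T).
Proof.
move=> a; apply: (@ampP _ _ _ _ _ (amp_mul (amp_inv a) a) (amp_one T) (mulVg (amp_g a))) => E L x.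
rewrite amp_mulE amp_invE -[RHS]/(fib_cast E (elag_act1 L) _).
have e : elag_act (amp_g a)^-1%g (elag_act (amp_g a) L) = L.
  by rewrite -elag_actM mulVg elag_act1.
rewrite (amp_iota_cast e) amp_iotaVK.
rewrite (@fib_cast_cast _ _ _ _ T E _ _ _ _ _ (etrans (congr1 (fun g => elag_act g L) (mulVg (amp_g a))) (elag_act1 L))).
by rewrite (@fib_cast_cast _ _ _ _ T E _ _ _ _ _ (etrans (congr1 (fun g => elag_act g L) (mulVg (amp_g a))) (elag_act1 L))).
Qed.
Fact amp_mulVr : right_inverse (amp_one T) (@amp_inv _ _ _ _ T) (@amp_mul _ _ _ _ T).
Proof.
move=> a; apply: (@ampP _ _ _ _ _ (amp_mul a (amp_inv a)) (amp_one T) (mulgV (amp_g a))) => E L x.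
rewrite amp_mulE amp_invE amp_iotaK -[RHS]/(fib_cast E (elag_act1 L) _).
rewrite (@fib_cast_cast _ _ _ _ T E _ _ _ _ _ (etrans (congr1 (fun g => elag_act g L) (mulgV (amp_g a))) (elag_act1 L))).
by rewrite (@fib_cast_cast _ _ _ _ T E _ _ _ _ _ (etrans (congr1 (fun g => elag_act g L) (mulgV (amp_g a))) (elag_act1 L))).
Qed.
Definition AMp_grp : grp := Grp amp_mulA amp_mul1 amp_mulr1 amp_mulV amp_mulVr.
End AMpGroup.

Section FourthRoots.
Variable F : fieldType.
Record mu4 := Mu4 { mu4_val :> F; mu4P : mu4_val ^+ 4 == 1 }.
HB.instance Definition _ := [isSub for mu4_val].
HB.instance Definition _ := [Choice of mu4 by <:].

Fact mu4_one_subproof : (1 : F) ^+ 4 == 1.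
Proof. by rewrite expr1n. Qed.
Definition mu4_one := Mu4 mu4_one_subproof.
Fact mu4_mul_subproof (x y : mu4) : (mu4_val x * mu4_val y) ^+ 4 == 1.
Proof. by rewrite exprMn (eqP (mu4P x)) (eqP (mu4P y)) mulr1. Qed.
Definition mu4_mul x y := Mu4 (mu4_mul_subproof x y).
Fact mu4_inv_subproof (x : mu4) : (mu4_val x)^-1 ^+ 4 == 1.
Proof. by rewrite exprVn (eqP (mu4P x)) invr1. Qed.
Definition mu4_inv x := Mu4 (mu4_inv_subproof x).

Lemma mu4_neq0 (x : mu4) : mu4_val x != 0.
Proof. by apply/eqP => x0; have := mu4P x; rewrite x0 expr0n eq_sym oner_eq0. Qed.

Fact mu4_mulA : associative mu4_mul.
Proof. by move=> x y z; apply: val_inj; rewrite /= mulrA. Qed.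
Fact mu4_mul1 : left_id mu4_one mu4_mul.
Proof. by move=> x; apply: val_inj; rewrite /= mul1r. Qed.
Fact mu4_mulr1 : right_id mu4_one mu4_mul.
Proof. by move=> x; apply: val_inj; rewrite /= mulr1. Qed.
Fact mu4_mulV : left_inverse mu4_one mu4_inv mu4_mul.
Proof. by move=> x; apply: val_inj; rewrite /= mulVf ?mu4_neq0. Qed.
Fact mu4_mulVr : right_inverse mu4_one mu4_inv mu4_mul.
Proof. by move=> x; apply: val_inj; rewrite /= divff ?mu4_neq0. Qed.
HB.instance Definition _ :=
  isGroup.Build mu4 mu4_mulA mu4_mul1 mu4_mulr1 mu4_mulV mu4_mulVr.
End FourthRoots.

Record central_extension (N E G : grp) (i : N -> E) (p : E -> G) : Prop := {
  ce_iM : forall x y, i (grp_mul x y) = grp_mul (i x) (i y);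
  ce_pM : forall x y, p (grp_mul x y) = grp_mul (p x) (p y);
  ce_inj : injective i;
  ce_surj : forall g, exists e, p e = g;
  ce_exact : forall e, p e = grp_one G <-> exists x, e = i x;
  ce_central : forall x e, grp_mul (i x) e = grp_mul e (i x) }.

(* Main.v *)
From HB Require Import structures.
From mathcomp Require Import all_boot all_order all_fingroup all_algebra all_field.
From mathcomp Require Import all_classical all_reals all_analysis.
From mathcomp Require Import complex ring.
Require Import Defs.

(** The group AMp(V) is an extension of ASp(V) by the fourth roots of unity because
    the Weil gerbe is a connected groupoid in which every object has automorphism
    group mu_4.

    - It is not empty ([weil_obj_exists]). The representations H_L satisfy the Schur
      lemma ([schur]). Hence the intertwiners H_L -> H_M form a line, spanned by
      matrix coefficients of T_{M,L} in three of the four tensor slots, and T_{M,L}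
      is the fourth tensor power of an intertwiner E_{M,L} ([fourth_root]). Choosing
      these roots for a fixed L trivializes H itself.
    - Two objects are isomorphic ([weil_hom_exists], [weil_hom_iso]): a morphism is
      determined over one Lagrangian, and phi_2^-1 phi_1 is one there.
    - Two morphisms with the same ends differ by a fourth root of unity
      ([weil_hom_unique]), by the Schur lemma again.

    Given these facts, an isomorphism of functors g^* -> Id amounts to a morphism
    g^* E0 -> E0 for a single object E0: such a morphism exists ([amp_lift]), and for
    g = 1 it is a scalar ([amp_mu_exact]). Scalars are central because pullbacks and
    the isomorphisms are linear.

    The Schur lemma rests on two properties of psi. It is a character ([psiD]), which
    means that the trace of an integer of K lies in Z_2 ([field_trace_int]); this
    follows from the Gauss lemma over Z_2 ([gauss_monic]). It is not trivial on 2R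
    when V <> 0 ([psi_nontrivial]): otherwise F_{M,L} would not be injective for the
    reductions M and L of the Lagrangians of the given splitting, while a multiple
    of its fourth tensor power is the bijection T_{M,L}. *)

Set Implicit Arguments.
Unset Strict Implicit.
Unset Printing Implicit Defensive.

Import Order.TTheory GRing.Theory Num.Theory.
Local Open Scope ring_scope.

(** * Two-adic integers and the Gauss lemma *)

Local Notation toQ2 := (@tofrac padic2).

Section FractionNumden.
Import FracField.
Local Open Scope quotient_scope.

Lemma fraction_numden (D : idomainType) (z : {fraction D}) :
  exists a b : D, b != 0 /\ z * @tofrac D b = @tofrac D a.
Proof.
elim/quotW: z => f; exists (frac f).1, (frac f).2; split; first exact: denom_ratioP.
rewrite -[LHS]/(FracField.mul _ _) !piE.
apply/eqmodP => /=.
by rewrite /FracField.mulf equivfE !numden_Ratio ?mulf_neq0 ?denom_ratioP ?oner_neq0 // !mulr1 mulrC.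
Qed.
End FractionNumden.

Definition padic2_mod2 (x : padic2) : 'F_2 := (res x 1)%:R.

Lemma natr_mod2 k : ((k %% 2)%N)%:R = k%:R :> 'F_2.
Proof. by rewrite {2}(divn_eq k 2) natrD natrM (_ : 2%:R = 0) ?mulr0 ?add0r //; apply/val_inj. Qed.

Fact padic2_mod2_zmod : zmod_morphism padic2_mod2.
Proof.
move=> x y; apply/eqP; rewrite eq_sym subr_eq; apply/eqP.
rewrite /padic2_mod2 -natrD -[LHS]natr_mod2 -[RHS]natr_mod2; congr _%:R.
have {1}-> : x = (x - y) + y by rewrite subrK.
by rewrite /= modn_mod.
Qed.
Fact padic2_mod2_monoid : monoid_morphism padic2_mod2.
Proof.
split=> [|x y]; first by apply/val_inj.
by rewrite /padic2_mod2 /= natr_mod2 natrM.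
Qed.
HB.instance Definition _ := GRing.isZmodMorphism.Build padic2 'F_2 padic2_mod2 padic2_mod2_zmod.
HB.instance Definition _ := GRing.isMonoidMorphism.Build padic2 'F_2 padic2_mod2 padic2_mod2_monoid.

Lemma padic2_mod2_2 : padic2_mod2 2%:R = 0.
Proof. by rewrite rmorph_nat; apply/val_inj. Qed.

Lemma padic2_natE k n : res (k%:R : padic2) n = (k %% 2 ^ n)%N.
Proof.
elim: k => [|k IH]; first by rewrite mod0n /= mod0n.
by rewrite -addn1 natrD /= IH modnDm.
Qed.

Lemma padic2_mod2E x n : (0 < n)%N -> padic2_mod2 x = (odd (res x n))%:R.
Proof.
by move=> n0; rewrite /padic2_mod2 -(res_mod_le x n0) expn1 natr_mod2 -natr_mod2 modn2.
Qed.

Lemma padic2_mulE x y n : res (x * y) n = (res x n * res y n %% 2 ^ n)%N.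
Proof. by []. Qed.

Lemma padic2_mod2_eq0 x : padic2_mod2 x = 0 -> exists y, x = 2%:R * y.
Proof.
move=> h1.
have ev n : (0 < n)%N -> ~~ odd (res x n).
  by move=> n0; move: h1; rewrite (padic2_mod2E x n0); case: odd.
have hc : coherent (fun n => (res x n.+1)./2).
  move=> n; rewrite -!divn2.
  rewrite -(res_mod_le x (leqnSn n.+1)); set r := res x n.+2.
  rewrite {1}(divn_eq r (2 ^ n.+1)) {2}expnS (mulnCA _ 2%N) (mulnC 2%N) divnMDl //.
  by rewrite modnMDl.
exists (of_coherent hc); apply: padic2P => n; rewrite padic2_mulE padic2_natE modnMml modnMmr mul2n.
have := odd_double_half (res x n.+1); rewrite (negPf (ev n.+1 _)) // add0n => ->.
by rewrite resP.
Qed.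

(** Each residue of x is odd, hence invertible modulo 2^n; inverses modulo 2^n
    are unique, so they form a coherent sequence. *)
Lemma padic2_odd_unit x : padic2_mod2 x != 0 -> x \is a GRing.unit.
Proof.
move=> hx.
have odd_res n : (0 < n)%N -> coprime (2 ^ n) (res x n).
  move=> n0; rewrite coprime_pexpl // coprime2n.
  by move: hx; rewrite (padic2_mod2E x n0); case: odd.
have inv n : exists y, (y * res x n = 1 %[mod 2 ^ n])%N.
  case: n => [|n]; first by exists 0%N; rewrite !modn1.
  have [] := @egcdnP (res x n.+1) (2 ^ n.+1).
    by have := odd_res n.+1 isT; case: (res x n.+1) => //; rewrite /coprime gcdn0 -{2}(expn0 2) eqn_exp2l.
  move=> km kn e _; exists km.
  by rewrite e modnMDl; move: (odd_res n.+1 isT); rewrite /coprime gcdnC => /eqP; rewrite gcdnC => ->.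
have [y hy] := choice inv.
have hc : coherent y.
  move=> n; have /(congr1 (fun k => k %% 2 ^ n)%N) := hy n.+1.
  rewrite !modn_dvdm ?expnS ?dvdn_mull // -(modnMmr _ (res x n.+1)) resP => e.
  rewrite -[y n.+1]muln1 -[y n]muln1 -modnMmr -(hy n) modnMmr mulnA.
  by rewrite (mulnC (y n.+1)) -mulnA -modnMmr e modnMmr.
apply/asboolP; exists (of_coherent hc); apply: padic2P => n /=.
by rewrite modnMml hy.
Qed.

Lemma padic2_factor x : x != 0 -> exists k (u : padic2), x = 2%:R ^+ k * u /\ u \is a GRing.unit.
Proof.
move=> x0; have [n] : exists n, res x n != 0%N.
  apply: contrapT => h; case/eqP: x0; apply: padic2P => n /=.
  by rewrite mod0n; apply/eqP/negPn/negP => hn; apply: h; exists n.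
elim: n x {x0} => [|n IH] x hx; first by have := res_lt x 0; rewrite expn0; case: (res x 0) hx.
have [/padic2_mod2_eq0[y e]|/padic2_odd_unit hu] := eqVneq (padic2_mod2 x) 0; last first.
  by exists 0%N, x; rewrite mul1r.
have [|k [u [ey hu]]] := IH y; last by exists k.+1, u; rewrite exprS -mulrA -ey.
apply: contraNneq hx => hy; rewrite e padic2_mulE padic2_natE modnMml.
have := resP y n; rewrite hy => /eqP; rewrite -/(dvdn _ _) => h.
by rewrite expnS -/(dvdn _ _) dvdn_pmul2l.
Qed.

Lemma toQ2_2_neq0 : toQ2 2%:R != 0.
Proof. by rewrite tofrac_eq0; apply/eqP => /(congr1 (fun x => res x 2)). Qed.

Lemma Q2_denom (z : Q2) : exists k a, toQ2 2%:R ^+ k * z = toQ2 a.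
Proof.
have [a [b [b0 e]]] := fraction_numden z.
have [k [u [eb hu]]] := padic2_factor b0.
exists k, (a * u^-1); rewrite rmorphM /= -e eb !rmorphM rmorphXn /= -!mulrA -[toQ2 u * _]rmorphM mulrV //.
by rewrite rmorph1 mulr1 mulrC.
Qed.

Lemma Q2_poly_denom (q : {poly Q2}) :
  exists k Q, toQ2 2%:R ^+ k *: q = map_poly toQ2 Q.
Proof.
elim/poly_ind: q => [|q c [k [Q e]]]; first by exists 0%N, 0; rewrite scaler0 rmorph0.
have [l [a ea]] := Q2_denom c.
move: e ea; set t : padic2 := 2%:R; move: t => t e ea.
exists (k + l)%N, (t ^+ l *: Q * 'X + (t ^+ k * a)%:P).
rewrite rmorphD rmorphM /= map_polyX map_polyC /= map_polyZ -e rmorphM !rmorphXn /= -ea.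
by rewrite scalerA -exprD addnC scalerDr -scalerAl mulrA -exprD addnC -!mul_polyC polyCM.
Qed.

Lemma map_poly_mod2_eq0 (Q : {poly padic2}) :
  map_poly padic2_mod2 Q = 0 -> exists Q', Q = 2%:R *: Q'.
Proof.
move=> h; have hi i : exists y, Q`_i = 2%:R * y.
  by apply: padic2_mod2_eq0; rewrite -coef_map h coef0.
have [y hy] := choice hi.
exists (\poly_(i < size Q) y i); apply/polyP => i; rewrite coefZ coef_poly.
by case: ltnP => hi'; [exact: hy | rewrite mulr0 nth_default].
Qed.

(** After clearing denominators by powers of 2, one has Q R = 2^(a+b) p over Z_2.
    As long as a + b > 0 the product vanishes modulo 2, hence so does a factor,
    because F_2[X] is a domain; that factor can be halved. Its leading
    coefficient, 2^a or 2^b, is then even, so that halving lowers a or b. *)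
Lemma gauss_monic (p : {poly padic2}) (q r : {poly Q2}) :
  q \is monic -> r \is monic -> q * r = map_poly toQ2 p ->
  exists Q, q = map_poly toQ2 Q.
Proof.
move=> mq mr e.
have toQ2_inj : injective (map_poly toQ2).
  by apply: map_inj_poly (rmorph0 _) => x y /eqP; rewrite tofrac_eq => /eqP.
have [a [Q hQ]] := Q2_poly_denom q; have [b [R hR]] := Q2_poly_denom r.
have [m] := ubnP (a + b); elim: m a b Q R hQ hR => // m IH [|a] b Q R hQ hR hm.
  by exists Q; rewrite -hQ scale1r.
have halve k (s : {poly Q2}) P : toQ2 2%:R ^+ k.+1 *: s = map_poly toQ2 P ->
    map_poly padic2_mod2 P = 0 -> exists P', toQ2 2%:R ^+ k *: s = map_poly toQ2 P'.
  move=> hP /map_poly_mod2_eq0[P' eP]; exists P'.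
  apply: (scalerI toQ2_2_neq0); rewrite scalerA -exprS hP eP.
  by rewrite map_polyZ.
have : map_poly padic2_mod2 (Q * R) = 0.
  have -> : Q * R = 2%:R ^+ (a.+1 + b) *: p.
    apply: toQ2_inj; rewrite rmorphM /= -hQ -hR map_polyZ rmorphXn /= -e.
    by rewrite -scalerAl -scalerAr scalerA -exprD.
  by rewrite map_polyZ /= exprS mulrC rmorphM /= padic2_mod2_2 mulr0 scale0r.
rewrite rmorphM => /eqP; rewrite mulf_eq0 => /orP[]/eqP h0.
  have [Q' hQ'] := halve _ _ _ hQ h0.
  exact: IH hQ' hR _.
(* R vanishes modulo 2, so it is not monic and b > 0. *)
case: b hR hm => [|b] hR hm.
  have /(congr1 lead_coef) := hR; rewrite scale1r (monicP mr) => lr.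
  suff : lead_coef R = 1.
    have m1 : padic2_mod2 1 = 1 by apply: rmorph1.
    move=> lR; have := lead_coef_map_eq (f := padic2_mod2) (p := R).
    rewrite lR /= m1 => /(_ isT); rewrite [map_poly _ _]h0 lead_coef0.
    by move=> /eqP; rewrite eq_sym oner_eq0.
  apply/eqP; rewrite -tofrac_eq rmorph1 [X in _ == X]lr lead_coef_map_inj //.
    by move=> x y /eqP; rewrite tofrac_eq => /eqP.
have [R' hR'] := halve _ _ _ hR h0.
by apply: IH hQ hR' _; rewrite addnS in hm.
Qed.

(** * The trace of an integral element *)

Section Regular.
Variables (F : fieldType) (K : fieldExtType F).
Local Notation d := (\dim {:K}).
Local Notation b := (vbasis {:K}).

(** Multiplication by x in coordinates. Vectors are rows, so [regmx] reverses
    products. *)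
Definition regmx (x : K) : 'M[F]_d := \matrix_(i, j) coord b j (x * b`_i).

Fact regmx_linear : linear regmx.
Proof. by move=> a x y; apply/matrixP => i j; rewrite !mxE mulrDl -scalerAl linearP. Qed.
HB.instance Definition _ := GRing.isLinear.Build F K 'M[F]_d *:%R regmx regmx_linear.

Lemma regmxM x y : regmx (x * y) = regmx y *m regmx x.
Proof.
apply/matrixP => i j; rewrite !mxE -mulrA (coord_vbasis (memvf (y * b`_i))).
rewrite mulr_sumr linear_sum; apply: eq_bigr => k _.
by rewrite -scalerAr linearZ !mxE.
Qed.

Lemma regmx1 : regmx 1 = 1%:M.
Proof.
apply/matrixP => i j; rewrite !mxE mul1r coord_free //.
exact: basis_free (vbasisP _).
Qed.

Lemma regmxD_scalar x c : regmx (x + c%:A) = regmx x + c%:M.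
Proof. by rewrite addrC linearP /= regmx1 scalemx1 addrC. Qed.

(** For M the matrix of x, X - M divides q(X) - q(M) and q(M) = 0; take the
    determinants of both sides of (X - M) B = q(X). *)
Lemma char_poly_regmx_dvd (x : K) (q : {poly F}) :
  root (map_poly (in_alg K) q) x ->
  exists r, char_poly (regmx x) * r = q ^+ d.
Proof.
suff h : exists B, char_poly_mx (regmx x) *m B =
    q%:M - map_mx polyC (regmx (map_poly (in_alg K) q).[x]).
  move=> /eqP q0; have [B] := h.
  rewrite q0 linear0 map_mx0 subr0 => /(congr1 determinant).
  by rewrite det_mulmx det_scalar => e; exists (\det B).
elim/poly_ind: q => [|q c [B hB]].
  by exists 0; rewrite mulmx0 map_poly0 horner0 linear0 map_mx0 subr0 raddf0.
exists ('X *: B + map_mx polyC (regmx (map_poly (in_alg K) q).[x])).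
rewrite (rmorphD (map_poly _)) (rmorphM (map_poly _)) /= map_polyX map_polyC /= !hornerE; set y := (map_poly _ q).[x] in hB *.
rewrite mulmxDr -scalemxAr hB /char_poly_mx mulmxBl mul_scalar_mx.
rewrite -map_mxM -regmxM regmxD_scalar scalerBr addrA subrK scale_scalar_mx.
rewrite mulrC [in RHS]raddfD /= map_mxD map_scalar_mx opprD addrACA.
by rewrite subrr addr0.
Qed.
End Regular.

Lemma field_trace_mx (K : fieldExtType Q2) (x : K) : field_trace x = \tr (regmx x).
Proof. by apply: eq_bigr => i _; rewrite mxE. Qed.

(** The characteristic polynomial of multiplication by x divides a power of a
    monic polynomial over Z_2, so by the Gauss lemma its coefficients, among
    them the trace up to sign, lie in Z_2. *)
Lemma field_trace_int (K : fieldExtType Q2) (x : int_ring K) :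
  exists a, field_trace (int_val x) = toQ2 a.
Proof.
case: x => x /= /asboolP[p mp px].
have [r hr] : exists r, char_poly (regmx x) * r = (map_poly toQ2 p) ^+ \dim {:K}.
  by apply: char_poly_regmx_dvd; rewrite -map_poly_comp.
have mc := char_poly_monic (regmx x).
have mr : r \is monic.
  by rewrite -(monicMl _ mc) hr monic_exp // monic_map.
have [|Q hQ] := @gauss_monic (p ^+ \dim {:K}) _ _ mc mr; first by rewrite hr rmorphXn.
exists (- Q`_(\dim {:K}).-1); rewrite field_trace_mx rmorphN /= -coef_map /= -hQ.
by rewrite char_poly_trace ?opprK // adim_gt0.
Qed.

(** * The character psi of R *)

Lemma natr_mod4 k : ((k %% 4)%N)%:R = k%:R :> 'Z_4.
Proof. by rewrite {2}(divn_eq k 4) natrD natrM (_ : 4%:R = 0) ?mulr0 ?add0r //; apply/val_inj. Qed.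

Lemma padic2_mod4D : {morph padic2_mod4 : x y / x + y}.
Proof. by move=> x y; rewrite /padic2_mod4 /= natr_mod4 natrD. Qed.

Lemma padic2_mod4_mul4 x : padic2_mod4 (2%:R ^+ 2 * x) = 0.
Proof.
rewrite /padic2_mod4 -natrX padic2_mulE padic2_natE natr_mod4 natrM natr_mod4.
by rewrite [X in X * _](_ : _ = 0) ?mul0r //; apply/val_inj.
Qed.

Lemma int_val_mulrn (K : fieldExtType Q2) (x : int_ring K) k :
  int_val (x *+ k) = int_val x *+ k.
Proof. exact: (raddfMn (\val : int_ring K -> K)). Qed.

Section Trace.
Variable A : unramified_ext.
Local Notation K := (ur_field A).

Lemma field_traceB (x y : K) : field_trace (x - y) = field_trace x - field_trace y.
Proof. by rewrite !field_trace_mx !raddfB. Qed.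

Lemma field_traceD (x y : K) : field_trace (x + y) = field_trace x + field_trace y.
Proof. by rewrite !field_trace_mx !raddfD. Qed.

(** Two integral lifts of a class of R differ by some 4 w, and the trace of w lies
    in Z_2: so any lift computes [ur_trace]. *)
Lemma ur_traceE (x : int_ring K) a :
  field_trace (int_val x) = toQ2 a -> ur_trace (ur_red2 A x) = padic2_mod4 a.
Proof.
move=> ea; rewrite /ur_trace; case: xgetP => [_ ->|/(_ (padic2_mod4 a)) []]; last by exists x, a.
move=> [y [b [ey eb ->]]].
have /(ur_red2P A).2[w ew] : ur_red2 A (y - x) = 0 by rewrite rmorphB ey subrr.
have [c ec] := field_trace_int w.
have -> : b = a + 2%:R ^+ 2 * c.
  apply/eqP; rewrite -tofrac_eq rmorphD rmorphM rmorphXn rmorph_nat /= -ea -eb -ec.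
  rewrite addrC -subr_eq -field_traceB -[_ - _]/(int_val (y - x)) ew.
  rewrite -!natrX; apply/eqP.
  have -> : int_val ((2 ^ 2)%:R * w) = int_val w *+ (2 ^ 2) by rewrite mulr_natl int_val_mulrn.
  by rewrite !field_trace_mx !raddfMn /= mulr_natl.
by rewrite padic2_mod4D padic2_mod4_mul4 addr0.
Qed.

Lemma ur_traceD : {morph @ur_trace A : z w / z + w}.
Proof.
move=> z w; have [[x <-] [y <-]] := ((ur_red2P A).1 z, (ur_red2P A).1 w).
have [[a ea] [b eb]] := (field_trace_int x, field_trace_int y).
rewrite -rmorphD (ur_traceE ea) (ur_traceE eb) -padic2_mod4D.
by apply: ur_traceE; rewrite /= field_traceD ea eb rmorphD.
Qed.

Variable Rr : realType.

Lemma expiD (s t : Rr) : expi (s + t) = expi s * expi t.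
Proof. by rewrite /expi cosD sinD; congr Complex; rewrite addrC. Qed.

Lemma expi_quarter k : expi (2 * pi / 4 * (k %% 4)%N%:R : Rr) = expi (2 * pi / 4 * k%:R).
Proof.
have e1 m : expi (2 * pi * m%:R : Rr) = 1.
  elim: m => [|m IH]; first by rewrite mulr0 /expi cos0 sin0.
  by rewrite -[m.+1]addn1 [((_ + 1)%N)%:R]natrD mulrDr expiD IH mul1r mulr1 mulr_natl /expi cos2pi sin2pi.
have -> : (2 * pi / 4 * k%:R : Rr) = 2 * pi * (k %/ 4)%:R + 2 * pi / 4 * (k %% 4)%:R.
  rewrite {1}(divn_eq k 4) [((_ + _)%N)%:R]natrD [((_ * 4)%N)%:R]natrM mulrDr.
  by congr (_ + _); rewrite (mulrC _ 4%:R) mulrA mulfVK ?pnatr_eq0.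
by rewrite expiD e1 mul1r.
Qed.

Lemma psiD (z w : ur_R A) : psi Rr (z + w) = psi Rr z * psi Rr w.
Proof.
by rewrite /psi ur_traceD /= expi_quarter natrD mulrDr expiD.
Qed.

Lemma psi0 : psi Rr (0 : ur_R A) = 1.
Proof.
rewrite /psi; suff -> : ur_trace (0 : ur_R A) = 0 by rewrite mulr0 /expi cos0 sin0.
by apply: (addrI (ur_trace (0 : ur_R A))); rewrite -ur_traceD !addr0.
Qed.

End Trace.

(** * Lagrangians *)

Section Residue.
Variable A : unramified_ext.
Local Notation R := (ur_R A).
Local Notation O := (int_ring (ur_field A)).

Lemma int_ring_mul2I (x y : O) : 2%:R * x = 2%:R * y -> x = y.
Proof.
rewrite (mulr_natl x 2) (mulr_natl y 2) => /(congr1 (@int_val _)).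
rewrite !int_val_mulrn -(mulr_natl (int_val x) 2) -(mulr_natl (int_val y) 2).
move=> h; apply: val_inj; apply: mulfI h.
rewrite -(rmorph_nat (in_alg (ur_field A))) fmorph_eq0 -(rmorph_nat toQ2).
exact: toQ2_2_neq0.
Qed.

Lemma ur_mul2_eq0 (r : R) : 2%:R * r = 0 -> exists s, r = 2%:R * s.
Proof.
have [x <-] := (ur_red2P A).1 r; rewrite -(rmorph_nat (ur_red2 A) 2) -rmorphM.
move=> /(ur_red2P A).2[y]; rewrite expr2 -mulrA => /int_ring_mul2I ->.
by exists (ur_red2 A y); rewrite -[RHS]rmorphM.
Qed.

(** A lift of r which is not divisible by 2 is a unit of O_K, the extension being
    unramified; and r is divisible by 2 only if 2 r = 0. *)
Lemma ur_inv (r : R) : 2%:R * r != 0 -> exists s, r * s = 1.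
Proof.
have [x <-] := (ur_red2P A).1 r => h; apply: contrapT => ninv.
have /(ur_unramified (u := A))[y ey] : ~ exists y, x * y = 1.
  by move=> [y xy]; apply: ninv; exists (ur_red2 A y); rewrite -rmorphM xy rmorph1.
by case/eqP: h; rewrite ey rmorphM /= rmorph_nat mulrA ur_four mul0r.
Qed.
End Residue.

Section Symplectic.
Variables (A : unramified_ext) (n : nat) (S : split_symplectic A n).
Local Notation R := (ur_R A).
Local Notation V := (ss_V S).
Local Notation om := (ss_omt S).

Lemma omt0l y : om 0 y = 0.
Proof.
have [_ l _ _] := ss_sympl S; apply: (addrI (om 0 y)).
by rewrite -[X in X + _]mul1r -l scaler0 !addr0.
Qed.
Lemma omt0r y : om y 0 = 0.
Proof.
have [_ _ l _] := ss_sympl S; apply: (addrI (om y 0)).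
by rewrite -[X in X + _]mul1r -l scaler0 !addr0.
Qed.
Lemma omtDl x y z : om (x + y) z = om x z + om y z.
Proof. by have [_ l _ _] := ss_sympl S; rewrite -[x in LHS]scale1r l mul1r. Qed.
Lemma omtDr x y z : om z (x + y) = om z x + om z y.
Proof. by have [_ _ l _] := ss_sympl S; rewrite -[x in LHS]scale1r l mul1r. Qed.
Lemma omtZl a x z : om (a *: x) z = a * om x z.
Proof. by have [_ l _ _] := ss_sympl S; rewrite -[a *: x]addr0 l omt0l addr0. Qed.
Lemma omtC x y : om x y = - om y x.
Proof.
have [alt _ _ _] := ss_sympl S; apply/eqP; rewrite -addr_eq0; apply/eqP.
by have := alt (x + y); rewrite omtDl !omtDr !alt add0r addr0.
Qed.

Lemma ss_mul2_eq0 (x : ss_Vt S) : 2%:R *: x = 0 -> ss_red S x = 0.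
Proof.
have [_ [e _ he]] := ss_free S; have [c [ec _]] := he x I.
move=> x2; apply/ss_redP.
have [c0 [_ uc0]] := he 0 I.
have c2 i : 2%:R * c i = 0.
  have e0 : c0 = [ffun=> 0].
    by apply: uc0; rewrite big1 // => j _; rewrite ffunE scale0r.
  have <- : c0 i = 2%:R * c i; last by rewrite e0 ffunE.
  rewrite (_ : c0 = [ffun i => 2%:R * c i]) ?ffunE //; apply: uc0.
  rewrite -[LHS]x2 ec scaler_sumr; apply: eq_bigr => j _.
  by rewrite ffunE scalerA.
have /choice[d hd] := fun i => ur_mul2_eq0 (c2 i).
exists (\sum_i d i *: e i); rewrite ec scaler_sumr.
by apply: eq_bigr => i _; rewrite hd scalerA.
Qed.

Lemma omega_nondegenerate (v : V) : (forall w, omega v w = 0) -> v = 0.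
Proof.
have [x <-] := ss_red_surj v => h; apply: ss_mul2_eq0.
have [_ _ _ nd] := ss_sympl S; apply: nd => y.
by rewrite omtZl -omegaE h.
Qed.

Lemma omegaC (v w : V) : omega v w = - omega w v.
Proof.
have [[x <-] [y <-]] := (ss_red_surj v, ss_red_surj w).
by rewrite !omegaE omtC mulrN.
Qed.

Lemma omega_beta (v w : V) : omega v w = beta v w - beta w v.
Proof.
have [[x <-] [y <-]] := (ss_red_surj v, ss_red_surj w).
rewrite omegaE !betaE -mulrBr /ss_betat; congr (_ * _).
have [xL xM ex] := ss_partsP x; have [yL yM ey] := ss_partsP y.
rewrite {1}ex {1}ey omtDl !omtDr.
rewrite (iffLR (ss_L0_lag _) xL _ yL) (iffLR (ss_M0_lag _) xM _ yM) add0r addr0.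
by rewrite [X in _ + X]omtC.
Qed.

Lemma omegaZl x (v w : V) : omega (ur_red1 A x *: v) w = ur_red2 A x * omega v w.
Proof.
have [[y <-] [z <-]] := (ss_red_surj v, ss_red_surj w).
by rewrite -ss_redZ !omegaE omtZl mulrCA.
Qed.

Lemma elag_subZ (L : elag S) a v : v \in el_sub L -> a *: v \in el_sub L.
Proof.
have [x <-] := (ur_red1P A).1 a.
by move=> /el_lag hv; apply/el_lag => w hw; rewrite omegaZl hv // mulr0.
Qed.

(** Some l0 in L pairs with v to a nonzero value 2 r, where r is then a unit of R;
    the other values in 2R are reached by scaling l0, as L is a k-subspace. *)
Lemma omega_values (L : elag S) v (z : R) : v \notin el_sub L ->
  exists2 l, l \in el_sub L & omega l v = 2%:R * z.
Proof.
move=> vL; have [l lL lv] : exists2 l, l \in el_sub L & omega l v != 0.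
  apply: contrapT => h; case/negP: vL; apply/el_lag => l hl.
  by rewrite omegaC; apply/eqP; rewrite oppr_eq0; apply/negPn/negP => h'; apply: h; exists l.
have [y ey] := ss_red_surj l; have [w ew] := ss_red_surj v.
have [s hs] : exists s, om y w * s = 1 by apply: ur_inv; rewrite -omegaE ey ew.
have [x hx] := (ur_red2P A).1 (s * z).
exists (ur_red1 A x *: l); first exact: elag_subZ.
rewrite omegaZl -ey -ew omegaE hx mulrCA; congr (_ * _).
by rewrite mulrC mulrA hs mul1r.
Qed.

(** The reduction modulo 2 of a Lagrangian with a Lagrangian complement; it is
    used for both terms of the splitting. Since beta vanishes on it, v |-> (v, 0)
    is a homomorphic section over it. *)
Section ReducedLagrangian.
Variable P Q : set (ss_Vt S).
Hypothesis PL : lagrangian om P.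
Hypothesis QL : lagrangian om Q.
Hypothesis PQ : forall x, exists p q, [/\ P p, Q q & x = p + q].
Hypothesis Pbeta : forall x y, P x -> P y -> ss_betat x y = 0.

Definition mod2_sub : {set V} := [set v | `[< exists2 x, P x & ss_red S x = v >]].

Lemma mod2_subP v : reflect (exists2 x, P x & ss_red S x = v) (v \in mod2_sub).
Proof. by rewrite inE; apply: asboolP. Qed.

Fact mod2_lag : lagrangian (@omega _ _ S) (fun v => v \in mod2_sub).
Proof.
move=> v; split=> [/mod2_subP[x Px <-] w /mod2_subP[y Py <-]|h].
  by rewrite omegaE (iffLR (PL _) Px _ Py) mulr0.
have [x ex] := ss_red_surj v; have [p [q [Pp Qq e]]] := PQ x.
have ev : v = ss_red S p + ss_red S q by rewrite -raddfD -e.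
suff q0 : ss_red S q = 0 by rewrite ev q0 addr0; apply/mod2_subP; exists p.
apply: omega_nondegenerate => w; have [y <-] := ss_red_surj w.
have [p' [q' [Pp' Qq' ->]]] := PQ y.
rewrite omegaE omtDr (iffLR (QL _) Qq _ Qq') addr0 -omegaE.
have /h : ss_red S p' \in mod2_sub by apply/mod2_subP; exists p'.
by rewrite ev omegaDl omegaE (iffLR (PL _) Pp _ Pp') mulr0 add0r.
Qed.

Definition mod2_tau : {ffun V -> heis S} :=
  [ffun v => if v \in mod2_sub then Heis v 0 else 1%g].

Fact mod2_sec : {in mod2_sub, forall l, hv (mod2_tau l) = l}.
Proof. by move=> l hl; rewrite ffunE hl. Qed.

Fact mod2_hom : {in mod2_sub &, forall l m, mod2_tau (l + m) = (mod2_tau l * mod2_tau m)%g}.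
Proof.
move=> l m hl hm; rewrite !ffunE hl hm.
case/mod2_subP: (hl) (hm) => x Px ex /mod2_subP[y Py ey].
have -> : l + m \in mod2_sub.
  apply/mod2_subP; exists (x + y); last by rewrite raddfD -ex -ey.
  by apply/PL => z Pz; rewrite omtDl (iffLR (PL _) Px) // (iffLR (PL _) Py) // addr0.
rewrite /mulg /= /heis_mul /= -{3}ex -{3}ey betaE Pbeta // mulr0 !addr0.

by [].
Qed.

Fact mod2_out v : v \notin mod2_sub -> mod2_tau v = 1%g.
Proof. by rewrite ffunE => /negPf ->. Qed.

Definition mod2_elag : elag S := ELag mod2_lag mod2_sec mod2_hom mod2_out.
End ReducedLagrangian.

Lemma transversal_elags : exists L M : elag S,
  general_position M L /\ (forall v, v \in el_sub M -> v \in el_sub L -> v = 0).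
Proof.
have L0l : lagrangian om (ss_L0 S) := @ss_L0_lag _ _ S.
have M0l : lagrangian om (ss_M0 S) := @ss_M0_lag _ _ S.
have LM x : exists p q, [/\ ss_L0 S p, ss_M0 S q & x = p + q].
  by have [[p q] [/= [Pp Qq e] _]] := @ss_split _ _ S x; exists p, q.
have ML x : exists p q, [/\ ss_M0 S p, ss_L0 S q & x = p + q].
  by have [p [q [Pp Qq e]]] := LM x; exists q, p; rewrite addrC.
have L00 : ss_L0 S 0 by apply/L0l => y _; rewrite omt0l.
have M00 : ss_M0 S 0 by apply/M0l => y _; rewrite omt0l.
have Lb x y : ss_L0 S x -> ss_L0 S y -> ss_betat x y = 0.
  by move=> Lx Ly; rewrite /ss_betat (@ss_parts_eq _ _ _ y y 0) ?addr0 ?omt0r.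
have Mb x y : ss_M0 S x -> ss_M0 S y -> ss_betat x y = 0.
  by move=> Mx My; rewrite /ss_betat (@ss_parts_eq _ _ _ x 0 x) ?add0r ?omt0l.
exists (mod2_elag L0l M0l LM Lb), (mod2_elag M0l L0l ML Mb).
have gp v : exists m l, [/\ m \in mod2_sub (ss_M0 S), l \in mod2_sub (ss_L0 S) & v = m + l].
  have [x <-] := ss_red_surj v; have [m [l [hm hl ->]]] := ML x.
  exists (ss_red S m), (ss_red S l); rewrite raddfD; split=> //; apply/mod2_subP; [by exists m|by exists l].
split=> // v /= vM vL; apply: omega_nondegenerate => w.
have [m [l [hm hl ->]]] := gp w; rewrite omegaC omegaDl.
rewrite (iffLR (mod2_lag M0l L0l ML _) hm) // (iffLR (mod2_lag L0l M0l LM _) hl) //.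
by rewrite addr0 oppr0.
Qed.

End Symplectic.

(** * Multilinear forms and tensor powers *)

Section Slots.
Variables (F : fieldType) (m : nat).

Lemma upd_id (X : Type) (u : 'I_m -> X) j : upd u j (u j) = u.
Proof. by apply/funext => i; rewrite /upd; case: eqP => // ->. Qed.

Lemma upd_eq (X : Type) (u : 'I_m -> X) j x : upd u j x j = x.
Proof. by rewrite /upd eqxx. Qed.

Lemma comp_upd (X Y : Type) (f : X -> Y) (u : 'I_m -> X) j x :
  (fun i => f (upd u j x i)) = upd (fun i => f (u i)) j (f x).
Proof. by apply/funext => i; rewrite /upd; case: eqP. Qed.

(** Replaces the arguments of Th by those of x0 one slot at a time, each
    replacement bringing out a factor. *)
Lemma slotwise_prod (X : Type) (Th : ('I_m -> X) -> F) (G : 'I_m -> X -> F) (x0 : 'I_m -> X) :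
  (forall u j x, Th (upd u j x) = G j x * Th (upd u j (x0 j))) ->
  forall u, Th u = (\prod_j G j (u j)) * Th x0.
Proof.
move=> hT u.
suff h s : (s <= m)%N -> Th u = (\prod_(j < m | (j < s)%N) G j (u j)) *
    Th (fun j => if (j < s)%N then x0 j else u j).
  rewrite (h m) //; congr (_ * Th _); first by apply: eq_bigl => j; rewrite ltn_ord.
  by apply/funext => j; rewrite ltn_ord.
elim: s => [|s IH] sm; first by rewrite big_pred0 // mul1r.
set j0 := Ordinal sm; set v := fun j : 'I_m => if (j < s)%N then x0 j else u j.
have -> : Th (fun j => if (j < s.+1)%N then x0 j else u j) = Th (upd v j0 (x0 j0)).
  congr (Th _); apply/funext => j; rewrite /upd /v -val_eqE /= ltnS leq_eqVlt.
  by case: eqP => //= e; congr (x0 _); apply: val_inj.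
have vj0 : v j0 = u j0 by rewrite /v ltnn.
rewrite (IH (ltnW sm)) -/v -[in LHS](upd_id v j0) hT vj0 [in RHS](bigD1 j0) //= -mulrA mulrCA.
congr (_ * (_ * _)); apply: eq_bigl => j.
by rewrite ltnS -val_eqE /= andbC ltn_neqAle.
Qed.

Section Multilinear.
Variable U : lmodType F.
Implicit Types (b : mlform m U) (u : 'I_m -> U).

Lemma mlform0 b u j : b (upd u j 0) = 0.
Proof.
apply: (addrI (b (upd u j 0))); rewrite addr0 -[X in X + _]mul1r.
by rewrite -mlformP scaler0 addr0.
Qed.

Lemma mlformZ b u j a x : b (upd u j (a *: x)) = a * b (upd u j x).
Proof. by rewrite -[a *: x]addr0 mlformP mlform0 addr0. Qed.

Lemma mlform_sum b u j (I : finType) (x : I -> U) :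
  b (upd u j (\sum_i x i)) = \sum_i b (upd u j (x i)).
Proof.
apply: (big_morph (fun y => b (upd u j y))); last exact: mlform0.
by move=> x1 x2; rewrite -[x1 in LHS]scale1r mlformP mul1r.
Qed.

Lemma mlform_scale b (c : 'I_m -> F) (w : 'I_m -> U) :
  b (fun j => c j *: w j) = (\prod_j c j) * b w.
Proof.
rewrite (@slotwise_prod _ (fun c => b (fun j => c j *: w j)) (fun _ x => x) (fun _ => 1)).
  by congr (_ * b _); apply/funext => j; rewrite scale1r.
move=> {}c j x.
have e y : (fun i => upd c j y i *: w i) = upd (fun i => c i *: w i) j (y *: w j).
  by apply/funext => i; rewrite /upd; case: eqP => [->|].
by rewrite !e !mlformZ mul1r.
Qed.

Fact prodform_subproof (la : 'I_m -> {linear U -> F^o}) i u a x y :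
  \prod_j la j (upd u i (a *: x + y) j) =
  a * \prod_j la j (upd u i x j) + \prod_j la j (upd u i y j).
Proof.
rewrite (bigD1 i) //= [\prod_j la j (upd u i x j)](bigD1 i) //=.
rewrite [\prod_j la j (upd u i y j)](bigD1 i) //= !upd_eq linearP mulrDl -mulrA.
by congr (_ * (_ * _) + _ * _); apply: eq_bigr => j /negPf ji; rewrite /upd ji.
Qed.
Definition prodform (la : 'I_m -> {linear U -> F^o}) : mlform m U :=
  @MLForm F m U (fun u => \prod_j la j (u j)) (@prodform_subproof la).

Fact tpure_subproof u : (fun b : mlform m U => b u : F^o) \in @tpow_pred F m U.
Proof.
apply/asboolP; exists [:: (1, u)]; apply/funext => b.
by rewrite big_seq1 mul1r.
Qed.
Definition tpure u : tpow m U := TPow (tpure_subproof u).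

Lemma tpureE u b : tpure u b = b u. Proof. by []. Qed.

Lemma tpowD (t t' : tpow m U) b : (t + t') b = t b + t' b.
Proof. by []. Qed.
Lemma tpowZ a (t : tpow m U) b : (a *: t) b = a * t b.
Proof. by []. Qed.
Lemma tpow_sum (I : Type) (s : seq I) (t : I -> tpow m U) b :
  (\sum_(i <- s) t i) b = \sum_(i <- s) t i b.
Proof. by apply: (big_morph (fun t : tpow m U => t b)). Qed.

Lemma tpow_repr (t : tpow m U) : exists s : seq (F * ('I_m -> U)),
  t = \sum_(p <- s) p.1 *: tpure p.2.
Proof.
have /asboolP[s es] := tpow_valP t; exists s; apply: tpowP => b.
by rewrite tpow_sum es.
Qed.

Lemma tpow_form_sum (t : tpow m U) (I : finType) (a : I -> F) b (c : I -> mlform m U) :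
  (forall u, b u = \sum_i a i * c i u) -> t b = \sum_i a i * t (c i).
Proof.
move=> e; have [s ->] := tpow_repr t.
rewrite tpow_sum (eq_bigr (fun p => \sum_i p.1 * (a i * c i p.2))); last first.
  by move=> p _; rewrite tpowZ tpureE e mulr_sumr.
rewrite exchange_big; apply: eq_bigr => i _; rewrite tpow_sum mulr_sumr.
by apply: eq_bigr => p _; rewrite tpowZ tpureE mulrCA.
Qed.

Lemma tpow_formZ (t : tpow m U) a (b c : mlform m U) : (forall u, b u = a * c u) -> t b = a * t c.
Proof.
move=> e; rewrite (@tpow_form_sum t 'I_1 (fun=> a) b (fun=> c)) ?big_ord1 //.
by move=> u; rewrite big_ord1.
Qed.

Lemma tpure_upd_linear u j : linear (fun x => tpure (upd u j x)).
Proof. by move=> a x y; apply: tpowP => b; rewrite tpowD tpowZ !tpureE mlformP. Qed.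
End Multilinear.

Lemma tmap_tpure (U W : lmodType F) (f : 'I_m -> {linear U -> W}) u :
  tmap f (tpure u) = tpure (fun j => f j (u j)).
Proof. exact: tpowP. Qed.

Lemma tmap_scale (U W : lmodType F) (c : 'I_m -> F) (f g : 'I_m -> {linear U -> W}) :
  (forall j x, g j x = c j *: f j x) -> forall t, tmap g t = (\prod_j c j) *: tmap f t.
Proof.
move=> e t; apply: tpowP => b; rewrite tpowZ /=.
apply: tpow_formZ => u /=; rewrite -mlform_scale; congr (mlform_fun b _).
by apply/funext => j.
Qed.

Section Separation.
Variables (U : lmodType F) (I : finType) (ev : I -> {linear U -> F^o}) (d : I -> U) (i0 : I).
Hypothesis evd : forall x, x = \sum_i ev i x *: d i.

Definition slotproj i (x : U) : U := ev i x *: d i.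
Fact slotproj_linear i : linear (slotproj i).
Proof. by move=> a x y; rewrite /slotproj linearP scalerDl scalerA. Qed.
HB.instance Definition _ i :=
  GRing.isLinear.Build F U U *:%R (slotproj i) (@slotproj_linear i).

(** Writing the identity of U as the sum over i of the rank one maps
    x |-> ev i x *: d i in one slot after the other, every multilinear form
    becomes a combination of products of the functionals ev i. *)
Lemma tpow_separation (t t' : tpow m U) :
  (forall k : 'I_m -> I, t (prodform (fun j => ev (k j))) = t' (prodform (fun j => ev (k j)))) ->
  t = t'.
Proof.
move=> h.
pose f s (k : 'I_m -> I) (j : 'I_m) : {linear U -> U} :=
  if (j < s)%N then (slotproj (k j) : {linear U -> U}) else (idfun : {linear U -> U}).
suff hs r s : (s + r)%N = m -> forall k, tmap (f s k) t = tmap (f s k) t'.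
  have := hs m 0 (add0n m) (fun=> i0).
  by rewrite !(tmap_id (f := f 0 (fun=> i0))) // => j x.
elim: r s => [|r IH] s => [|e].
  rewrite addn0 => -> k; apply: tpowP => b /=.
  have ef (x : tpow m U) : x (mlform_comp (f m k) b) =
      b (fun j => d (k j)) * x (prodform (fun j => ev (k j))).
    apply: tpow_formZ => u /=; rewrite mulrC -mlform_scale; congr (mlform_fun b _).
    by apply/funext => j; rewrite /f ltn_ord.
  by rewrite !ef h.
move=> k; apply: tpowP => b /=.
have sm : (s < m)%N by rewrite -e addnS ltnS leq_addr.
pose j0 := Ordinal sm.
have ef (x : tpow m U) : x (mlform_comp (f s k) b) =
    \sum_i 1 * x (mlform_comp (f s.+1 (upd k j0 i)) b).
  apply: tpow_form_sum => u /=.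
  have -> : (fun j => f s k j (u j)) =
      upd (fun j => f s k j (u j)) j0 (\sum_i slotproj i (u j0)).
    by rewrite -[X in upd _ _ X]evd -{1}(upd_id (fun j => f s k j (u j)) j0) /f ltnn.
  rewrite mlform_sum; apply: eq_bigr => i _; rewrite mul1r; congr (mlform_fun b _).
  apply/funext => j; rewrite /upd /f -val_eqE /= ltnS.
  case: eqP => [ej|ej] /=; first by have -> : j = j0; [apply/val_inj | rewrite /= leqnn].
  by rewrite [in RHS]leq_eqVlt; move/eqP/negPf: ej => ->.
rewrite !ef; apply: eq_bigr => i _; congr (_ * _).
have e1 : (s.+1 + r)%N = m by rewrite addSnnS.
exact: (congr1 (fun x : tpow m U => x b) (IH s.+1 e1 (upd k j0 i))).
Qed.
End Separation.

End Slots.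

(** * The representations H_L and the Schur lemma *)

Section HeisenbergGroup.
Variables (A : unramified_ext) (n : nat) (S : split_symplectic A n).
Implicit Types (L M : elag S) (h k : heis S).

Lemma heis_commute h k : (h * k)%g = (center S (omega (hv h) (hv k)) * (k * h))%g.
Proof.
case: h k => [v x] [w y]; rewrite /mulg /= /heis_mul /= add0r beta0l addr0 addrC.
by congr Heis; rewrite omega_beta; ring.
Qed.

(** For hv h in L, the central factor of h in Z tau(L); see [tau_decomp]. *)
Definition tau_coef L h := hz h - hz (el_tau L (hv h)).

Lemma tau_decomp L h : hv h \in el_sub L -> h = (center S (tau_coef L h) * el_tau L (hv h))%g.
Proof.
case: h => v x /= vL; rewrite /mulg /= /heis_mul /= el_sec // add0r beta0l addr0.
by rewrite /tau_coef /= subrK.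
Qed.

Lemma hv_mul h k : hv (h * k)%g = hv h + hv k. Proof. by []. Qed.
Lemma hz_mul h k : hz (h * k)%g = hz h + hz k + beta (hv h) (hv k). Proof. by []. Qed.
Lemma hv_center z : hv (center S z) = 0. Proof. by []. Qed.
Lemma hz_center z : hz (center S z) = z. Proof. by []. Qed.

Lemma tau_coef_mull L z l h : l \in el_sub L -> hv h \in el_sub L ->
  tau_coef L (center S z * el_tau L l * h)%g = z + tau_coef L h.
Proof.
move=> lL hL; rewrite /tau_coef !hv_mul el_sec // hv_center add0r el_hom //.
rewrite !hz_mul hv_mul !el_sec // hv_center add0r beta0l hz_center.
by ring.
Qed.

Lemma tau_coef_mulr L l h : l \in el_sub L -> hv h \in el_sub L ->
  tau_coef L (h * el_tau L l)%g = tau_coef L h.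
Proof.
move=> lL hL; rewrite /tau_coef hv_mul el_sec // el_hom // !hz_mul !el_sec //.
by ring.
Qed.
End HeisenbergGroup.

Section Delta.
Variables (Rr : realType) (A : unramified_ext) (n : nat) (S : split_symplectic A n).
Local Notation C := (Rr[i]).
Local Notation hfib := (hfib Rr).
Implicit Types (L M : elag S) (h k : heis S).

Section OneLagrangian.
Variable L : elag S.

Fact hdelta_subproof : [ffun h : heis S =>
   if hv h \in el_sub L then psi Rr (tau_coef L h) else 0 : C^o] \in @hfib_pred Rr A n S L.
Proof.
apply/asboolP => z l h lL; rewrite !ffunE.
have -> : (hv (center S z * el_tau L l * h)%g \in el_sub L) = (hv h \in el_sub L).
  rewrite !hv_mul hv_center add0r el_sec //; apply/idP/idP => [hh|]; last exact: elag_subD.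
  by rewrite -(addKr l (hv h)) elag_subD ?elag_subN.
case: ifP => hL; last by rewrite mulr0.
by rewrite tau_coef_mull // psiD.
Qed.
(** The function supported on Z tau(L), normalized by the value 1 at 1. It generates
    H_L and is fixed by tau(L). *)
Definition hdelta : hfib L := HFib hdelta_subproof.

Lemma hdeltaE h : hdelta h = if hv h \in el_sub L then psi Rr (tau_coef L h) else 0.
Proof. by rewrite ffunE. Qed.

Lemma hdelta1 : hdelta 1%g = 1.
Proof. by rewrite hdeltaE elag_sub0 /tau_coef /= el_tau0 subrr psi0. Qed.

Lemma hfib_actE (g h : heis S) (f : hfib L) : hfib_act g f h = f (h * g)%g.
Proof. by rewrite ffunE. Qed.

Lemma hdelta_tau l : l \in el_sub L -> hfib_act (el_tau L l) hdelta = hdelta.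
Proof.
move=> lL; apply: hfibP => h; rewrite hfib_actE !hdeltaE hv_mul el_sec //.
have -> : (hv h + l \in el_sub L) = (hv h \in el_sub L).
  apply/idP/idP => [hh|hh]; last exact: elag_subD.
  by rewrite -(addrK l (hv h)) elag_subD ?elag_subN.
by case: ifP => // hL; rewrite tau_coef_mulr.
Qed.

Definition hcard : C := #|[set h : heis S | hv h \in el_sub L]|%:R.

Lemma hcard_neq0 : hcard != 0.
Proof.
rewrite pnatr_eq0 -lt0n; apply/card_gt0P; exists 1%g.
by rewrite inE elag_sub0.
Qed.

(** Up to a scalar, the function supported on the coset of h; see [hfib_span]. *)
Definition hspan h : hfib L := hcard^-1 *: hfib_act h^-1%g hdelta.

Fact hev_linear h : linear (fun f : hfib L => f h : C^o).
Proof. by move=> a f f'; rewrite hfib_linE. Qed.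
Definition hev_fun h (f : hfib L) : C^o := f h.
HB.instance Definition _ h :=
  GRing.isLinear.Build C (hfib L) C^o *:%R (hev_fun h) (hev_linear h).
Definition hev h : {linear hfib L -> C^o} := hev_fun h.

Lemma hevE h f : hev h f = f h. Proof. by []. Qed.

Lemma hfib_sumE (I : Type) (s : seq I) (F : I -> hfib L) h :
  (\sum_(i <- s) F i) h = \sum_(i <- s) F i h.
Proof. exact: (raddf_sum (hev h)). Qed.

Lemma hfib_scaleE a (f : hfib L) h : (a *: f) h = a * f h.
Proof. by rewrite -[LHS]/(hev h (a *: f)) linearZ. Qed.

(** The terms with h = k^-1 h' and k in Z tau(L) contribute f h' each to the value
    at h' of the sum of the f h *: act h^-1 delta, and the others vanish. *)
Lemma hfib_span f : f = \sum_h hev h f *: hspan h.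
Proof.
apply: hfibP => h'; rewrite hfib_sumE.
under eq_bigr => h _ do rewrite !hfib_scaleE hfib_actE mulrCA hevE.
rewrite -mulr_sumr; apply: (mulfI hcard_neq0); rewrite mulVKf ?hcard_neq0 //.
rewrite (reindex_inj (h := fun k => (k^-1 * h')%g)) /=; last first.
  by move=> x y /mulIg /invg_inj.
rewrite /hcard -sum1_card natr_sum mulr_suml big_mkcond /=.
apply: eq_bigr => k _; rewrite invMg invgK mulKVg hdeltaE inE.
case: ifP => kL; last by rewrite mulr0.
by rewrite mul1r mulrC -(hfibE f _ _ kL) -tau_decomp // mulKVg.
Qed.

Lemma hdelta_neq0 : hdelta != 0.
Proof.
apply/eqP => /(congr1 (fun f : hfib L => f 1%g)); rewrite hdelta1 ffunE.
by apply/eqP; rewrite oner_eq0.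
Qed.

Lemma hfib_neq0 (f : hfib L) : f != 0 -> exists h, f h != 0.
Proof.
move=> f0; apply: contrapT => hf; case/eqP: f0; apply: hfibP => h.
rewrite [RHS]ffunE; apply/eqP/negPn/negP => h0; apply: hf; by exists h.
Qed.
End OneLagrangian.

Definition intertwiner L M (F : hfib L -> hfib M) :=
  linear F /\ forall g f, F (hfib_act g f) = hfib_act g (F f).

Section Nontrivial.
Variable T : canonical_trivialization Rr S.

Lemma tpure_const_neq0 m L (f : hfib L) : f != 0 -> tpure (fun _ : 'I_m => f) != 0.
Proof.
move=> /hfib_neq0[h fh]; apply/eqP => /(congr1 (fun t : tpow m (hfib L) => t (prodform (fun=> hev L h)))).
rewrite tpureE /= prodr_const card_ord => /eqP; rewrite -[X in _ == X]/(0 : C).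
by rewrite expf_eq0 (negPf fh) andbF.
Qed.

(** In general position the fourth tensor power of F_{M,L} is, up to a scalar, the
    bijection T_{M,L}; and f (x) ... (x) f is nonzero when f is. *)
Lemma Fop_inj L M (f : hfib L) : general_position M L -> Fop M f = 0 -> f = 0.
Proof.
move=> gp Ff; apply/eqP/negPn/negP => /(tpure_const_neq0 4)/negP; apply.
apply/eqP/(bij_inj (triv_bij (ctriv T) M L)); rewrite linear0.
rewrite (ctriv_normalized T gp) tmap_tpure /=.
apply/eqP; rewrite scaler_eq0; apply/orP; right; apply/eqP/tpowP => b.
rewrite tpureE (_ : (fun j => _) = upd (fun=> 0) ord0 0) ?mlform0 //.
by apply/funext => j; rewrite Ff /upd; case: eqP.
Qed.

(** Let (M, L) be in general position. If psi were trivial on 2R, then tau(M)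
    would act trivially on H_M, so that F_{M,L} would kill delta - tau(m) delta for
    every m in M. By injectivity delta would be fixed by tau(m), which is false for
    nonzero m. *)
Lemma psi_nontrivial (v : ss_V S) : v != 0 -> exists z : ur_R A, psi Rr (2%:R * z) != 1.
Proof.
move=> v0; apply: contrapT => triv.
have {}triv z : psi Rr (2%:R * z : ur_R A) = 1.
  by apply/eqP/negPn/negP => h; apply: triv; exists z.
have [L [M [gp LM0]]] := transversal_elags S.
(* A zero M is its own orthogonal V, contrary to V being nonzero. *)
have [m mM m0] : exists2 m, m \in el_sub M & m != 0.
  apply: contrapT => hM; case/eqP: v0; apply: LM0.
    apply/el_lag => w wM; have -> : w = 0.
      by apply/eqP/negPn/negP => w0; apply: hM; exists w.
    by rewrite omegaC omega0l oppr0.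
  apply: contrapT => vL; have [m [l [mM lL e]]] := gp v; apply: hM; exists m => //.
  by apply/eqP => m0; apply: vL; rewrite e m0 add0r.
pose f := hdelta L - hfib_act (el_tau M m) (hdelta L).
have f0 : f = 0.
  apply: (Fop_inj gp); rewrite linearB /=; apply/eqP; rewrite subr_eq0; apply/eqP.
  apply: hfibP => h; set d := hdelta L.
  have -> : Fop M (hfib_act (el_tau M m) d) = hfib_act (el_tau M m) (Fop M d).
    by apply: hfibP => k; rewrite hfib_actE !ffunE; apply: eq_bigr => l _; rewrite ffunE mulgA.
  rewrite hfib_actE heis_commute el_sec //.
  have [z ->] : exists z, omega (hv h) m = 2%:R * z by rewrite /omega; eexists.
  by rewrite mulgA hfibE // triv mul1r.
have := congr1 (fun f : hfib L => f 1%g) f0.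
rewrite /f ffunE [X in X + _]hdelta1 !ffunE mul1g el_sec //.
case: ifP => [mL|_]; first by case/eqP: m0; apply: LM0.
by move/eqP; rewrite oppr0 addr0 oner_eq0.
Qed.

(** The image e of delta is fixed by tau(L). Commuting tau(l) past h gives
    (psi(omega(l, v)) - 1) e(h) = 0 with v = hv h, so that e is supported on
    Z tau(L), where it is a multiple of delta; and delta generates H_L. *)
Lemma schur L (F : hfib L -> hfib L) : intertwiner F -> exists c, forall f, F f = c *: f.
Proof.
move=> [Flin Feqv]; set e := F (hdelta L); exists (e 1%g).
have FZ a f : F (a *: f) = a *: F f.
  have F0 : F 0 = 0 by have := Flin (-1) 0 0; rewrite scaler0 addr0 scaleN1r addNr.
  by rewrite -[a *: f]addr0 Flin F0 addr0.
have ee : e = e 1%g *: hdelta L.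
  apply: hfibP => h; rewrite hfib_scaleE hdeltaE.
  have einv l : l \in el_sub L -> e (h * el_tau L l)%g = e h.
    by move=> lL; rewrite -hfib_actE -Feqv hdelta_tau.
  case: (boolP (hv h \in el_sub L)) => hL.
    by rewrite {1}(tau_decomp hL) -[X in (_ * X)%g]mulg1 mulgA hfibE // mulrC.
  have [z hz] : exists z : ur_R A, psi Rr (2%:R * z) != 1.
    apply: (@psi_nontrivial (hv h)); apply: contraNneq hL => ->; exact: elag_sub0.
  have [l lL el] := omega_values z hL.
  have := einv _ (elag_subN lL).
  rewrite heis_commute el_sec ?elag_subN // mulgA hfibE ?elag_subN //.
  rewrite omegaC omegaNl opprK el => /eqP; rewrite -subr_eq0 -[X in _ - X]mul1r -mulrBl mulf_eq0.
  by rewrite subr_eq0 (negPf hz) /= mulr0 => /eqP.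
move=> f; rewrite {1}(hfib_span f).
have Fsum (I : Type) (s : seq I) (x : I -> hfib L) : F (\sum_(i <- s) x i) = \sum_(i <- s) F (x i).
  apply: (big_morph F); last by rewrite -[0 in LHS](scale0r 0) FZ scale0r.
  by move=> x1 x2; rewrite -[x1 in LHS]scale1r Flin scale1r.
rewrite Fsum [in RHS](hfib_span f) scaler_sumr; apply: eq_bigr => h _.
rewrite FZ scalerA [in RHS]mulrC -scalerA; congr (_ *: _).
by rewrite /hspan FZ Feqv -/e {1}ee linearZ /= !scalerA mulrC.
Qed.
End Nontrivial.
End Delta.

(** * Fourth roots of the canonical trivialization *)

Definition linear_of (F : fieldType) (U W : lmodType F) (f : U -> W) (hf : linear f) :
    {linear U -> W} :=
  HB.pack_for {linear U -> W} f (GRing.isLinear.Build F U W *:%R f hf).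

Section Slot.
Variables (Rr : realType) (A : unramified_ext) (n : nat) (S : split_symplectic A n).
Local Notation C := (Rr[i]).
Local Notation hfib := (hfib Rr).
Variable m : nat.

Definition eval_form (M : elag S) (h : 'I_m -> heis S) : mlform m (hfib M) :=
  prodform (fun j => hev Rr M (h j)).

Lemma tpow_hfib_ext M (t t' : tpow m (hfib M)) :
  (forall h, t (eval_form M h) = t' (eval_form M h)) -> t = t'.
Proof. exact: (tpow_separation 1%g (@hfib_span _ _ _ _ M)). Qed.

Lemma eval_form_upd M h j y u : eval_form M (upd h j y) u =
  u j y * \prod_(i < m | i != j) u i (h i).
Proof.
rewrite /= (bigD1 j) //= upd_eq hevE; congr (_ * _).
by apply: eq_bigr => i /negPf ij; rewrite /upd ij.
Qed.

Fact contract_subproof M (t : tpow m (hfib M)) h j :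
  [ffun y => t (eval_form M (upd h j y))] \in @hfib_pred Rr A n S M.
Proof.
apply/asboolP => z l y lM; rewrite !ffunE; apply: tpow_formZ => u.
by rewrite !eval_form_upd hfibE // mulrA.
Qed.
(** Contracts t with the evaluations at the h i for i <> j, which leaves an element
    of H_M in the slot j. *)
Definition contract M t h j : hfib M := HFib (contract_subproof t h j).

Lemma contractE M t h j y : contract (M := M) t h j y = t (eval_form M (upd h j y)).
Proof. by rewrite ffunE. Qed.

Definition hact (L : elag S) (g : heis S) : {linear hfib L -> hfib L} := @hfib_act Rr A n S L g.

Section Map.
Variables (L M : elag S) (T : {linear tpow m (hfib L) -> tpow m (hfib M)}).
Hypothesis Teq : forall (g : 'I_m -> heis S) t,
  T (tmap (fun i => hact L (g i)) t) = tmap (fun i => hact M (g i)) (T t).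

(** A matrix coefficient of T in all slots but the j-th, as a map H_L -> H_M in that
    slot. *)
Definition slot u h j (x : hfib L) : hfib M := contract (T (tpure (upd u j x))) h j.

Lemma slot_intertwiner u h j : intertwiner (slot u h j).
Proof.
split=> [a x y|g x].
  apply: hfibP => k; rewrite hfib_linE !contractE.
  by rewrite (tpure_upd_linear u j a x y) linearP.
apply: hfibP => k; rewrite hfib_actE !contractE.
have -> : tpure (upd u j (hfib_act g x)) =
    tmap (fun i => hact L (upd (fun=> 1%g) j g i)) (tpure (upd u j x)).
  rewrite tmap_tpure; congr tpure; apply/funext => i; rewrite /upd; case: eqP => //= _.
  by rewrite hfib_act1.
rewrite Teq -[RHS]mul1r /=; apply: tpow_formZ => w; rewrite mul1r.
rewrite -[LHS]/(eval_form M (upd h j k) (fun i => hact M (upd (fun=> 1%g) j g i) (w i))).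
rewrite !eval_form_upd upd_eq /= hfib_actE; congr (_ * _).
by apply: eq_bigr => i /negPf ij; rewrite /upd ij ffunE mulg1.
Qed.

Lemma slotE u h j x y : slot u h j x y = T (tpure (upd u j x)) (eval_form M (upd h j y)).
Proof. exact: contractE. Qed.

(** If the intertwiners H_L -> H_M are the multiples of F, then T is F in each slot
    up to a factor depending on the other slots; hence it is a multiple of the
    tensor power of F. *)
Lemma slot_factor (F : {linear hfib L -> hfib M}) (x0 : hfib L) (y0 : heis S) :
  F x0 y0 != 0 ->
  (forall F', intertwiner F' -> exists c, forall x, F' x = c *: F x) ->
  exists c, forall t, T t = c *: tmap (fun _ : 'I_m => F) t.
Proof.
move=> k0 gen; set k := F x0 y0 in k0.
pose Th (w : 'I_m -> hfib L * heis S) :=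
  T (tpure (fun j => (w j).1)) (eval_form M (fun j => (w j).2)).
have ThE := @slotwise_prod C m _ Th (fun _ p => F p.1 p.2 / k) (fun=> (x0, y0)).
exists (Th (fun=> (x0, y0)) / k ^+ m) => t.
have [s ->] := tpow_repr t; rewrite linear_sum [tmap _ _]linear_sum scaler_sumr; apply: eq_bigr => p _.
rewrite linearZ /= [tmap _ _]linearZ /= scalerA mulrC -scalerA; congr (_ *: _).
apply: tpow_hfib_ext => h; rewrite tpowZ tmap_tpure tpureE.
have /= := ThE _ (fun j => (p.2 j, h j)); rewrite /Th /= => ->.
  by rewrite prodf_div prodr_const card_ord [RHS]mulrC mulrAC [RHS]mulrA.
move=> w j q.
have [c hc] := gen _ (slot_intertwiner (fun i => (w i).1) (fun i => (w i).2) j).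
by rewrite /Th !comp_upd -!slotE !hc !hfib_scaleE /= mulrCA -mulrA mulVf // mulr1 mulrC.
Qed.
End Map.
End Slot.

Section FourthRoot.
Variables (Rr : realType) (A : unramified_ext) (n : nat) (S : split_symplectic A n).
Local Notation C := (Rr[i]).
Local Notation hfib := (hfib Rr).
Variable T : canonical_trivialization Rr S.

Lemma ctriv_eqv (L M : elag S) (g : 'I_4 -> heis S) t :
  ctriv T M L (tmap (fun i => hact Rr L (g i)) t) = tmap (fun i => hact Rr M (g i)) (ctriv T M L t).
Proof.
have := @triv_eqv _ _ _ _ _ _ (ctriv T) M L [ffun i => g i] t.
rewrite /= /tens_act => e; apply: etrans (etrans e _).
  by congr (ctriv T M L _); apply: tmap_ext => i x; rewrite ffunE.
by apply: tmap_ext => i x; rewrite ffunE.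
Qed.

Lemma slot_neq0 (L M : elag S) (x : hfib L) : x != 0 ->
  exists F : hfib L -> hfib M, intertwiner F /\ F x != 0.
Proof.
move=> x0.
(* A nonzero value of T_{M,L} on x (x) ... (x) x yields the slot. *)
have t0 : ctriv T M L (tpure (fun _ : 'I_4 => x)) != 0.
  apply: contra_neq (tpure_const_neq0 4 x0) => h.
  by apply: (bij_inj (triv_bij (ctriv T) M L)); rewrite linear0.
have [h h0] : exists h, ctriv T M L (tpure (fun _ : 'I_4 => x)) (eval_form Rr M h) != 0.
  apply: contrapT => ne; case/eqP: t0; apply: tpow_hfib_ext => h.
  by apply/eqP/negPn/negP => h0; apply: ne; exists h.
exists (slot (ctriv T M L) (fun=> x) h ord0); split.
  by apply: slot_intertwiner => g t; apply: ctriv_eqv.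
apply: contra_neq h0 => /(congr1 (fun f : hfib M => f (h ord0))).
by rewrite slotE !upd_id // => ->; rewrite ffunE.
Qed.

Lemma intertwiner_comp (L M N : elag S) (F : hfib L -> hfib M) (G : hfib M -> hfib N) :
  intertwiner F -> intertwiner G -> intertwiner (G \o F).
Proof.
move=> [Fl Fe] [Gl Ge]; split=> [a x y|g x] /=; first by rewrite Fl Gl.
by rewrite Fe Ge.
Qed.

(** T_{M,L} and T_{L,M} provide nonzero intertwiners F and G whose composite G F is
    nonzero. By the Schur lemma G F and F G are scalars, necessarily the same; so F
    is invertible, and the Schur lemma for F^-1 F' shows that F' is a multiple of F. *)
Lemma intertwiner_iso (L M : elag S) : exists (F : {linear hfib L -> hfib M}) (G : {linear hfib M -> hfib L}),
  [/\ cancel F G, cancel G F, intertwiner F &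
      forall F', intertwiner F' -> exists c, forall x, F' x = c *: F x].
Proof.
have [F [Fi F0]] := slot_neq0 M (hdelta_neq0 Rr L).
have [G [Gi G0]] := slot_neq0 L F0.
have [c hc] := schur T (intertwiner_comp Fi Gi).
have [c' hc'] := schur T (intertwiner_comp Gi Fi).
have c0 : c != 0 by apply: contra_neq G0 => c0; have /= -> := hc (hdelta Rr L); rewrite c0 scale0r.
pose Fl := linear_of Fi.1; pose Gl := linear_of Gi.1.
(* Evaluate F G F at delta. *)
have ec : c' = c.
  apply/eqP; rewrite -subr_eq0; have := hc' (F (hdelta Rr L)); have /= -> := hc (hdelta Rr L).
  rewrite -[F]/(Fl : _ -> _) linearZ => /eqP; rewrite eq_sym -subr_eq0 -scalerBl scaler_eq0.
  by rewrite (negPf F0) orbF.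
have k2 y : F (c^-1 *: G y) = y.
  rewrite -[F]/(Fl : _ -> _) linearZ /=; have /= -> := hc' y.
  by rewrite ec scalerA mulVf ?scale1r.
have G1 : linear (fun y => c^-1 *: G y).
  by move=> a x y; rewrite Gi.1 scalerDr !scalerA mulrC.
exists Fl, (linear_of G1); split=> //.
  by move=> x /=; have /= -> := hc x; rewrite scalerA mulVf ?scale1r.
move=> F' Fi'; have [d hd] := schur T (intertwiner_comp Fi' Gi).
exists (c^-1 * d) => x; have /= e := hd x.
by rewrite -[LHS]k2 e -[F]/(Fl : _ -> _) scalerA linearZ.
Qed.

(** T_{M,L} is a multiple c of the tensor power of an intertwiner F; so take b F with
    b^4 = c. *)
Lemma fourth_root (L M : elag S) : exists (F : {linear hfib L -> hfib M}) (G : {linear hfib M -> hfib L}),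
  [/\ cancel F G, cancel G F, intertwiner F &
      forall t, ctriv T M L t = tmap (fun _ : 'I_4 => F) t].
Proof.
have [F [G [FG GF Fi gen]]] := intertwiner_iso L M.
have [x0 [y0 xy0]] : exists x0 y0, F x0 y0 != 0.
  exists (hdelta Rr L); apply: hfib_neq0; apply: contra_neq (hdelta_neq0 Rr L) => h.
  by rewrite -[hdelta _ _]FG h linear0.
have [c hc] := slot_factor (@ctriv_eqv L M) xy0 gen.
have c0 : c != 0.
  apply: contra_neq (tpure_const_neq0 4 (hdelta_neq0 Rr L)) => c0.
  by apply: (bij_inj (triv_bij (ctriv T) M L)); rewrite linear0 hc c0 scale0r.
pose b : C := 4.-root c.
have b4 : b ^+ 4 = c by rewrite rootCK.
have b0 : b != 0 by apply: contra_neq c0; rewrite -b4 => ->; rewrite expr0n.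
have Fl : linear (fun x => b *: F x) by move=> a x y; rewrite linearP scalerDr !scalerA mulrC.
have Gl : linear (fun x => b^-1 *: G x) by move=> a x y; rewrite linearP scalerDr !scalerA mulrC.
exists (linear_of Fl), (linear_of Gl); split.
- by move=> x /=; rewrite linearZ /= FG scalerA mulVf ?scale1r.
- by move=> x /=; rewrite linearZ /= GF scalerA mulfV ?scale1r.
- by split=> // g x /=; rewrite Fi.2 -[RHS]/(hact Rr M g (b *: F x)) linearZ.
move=> t; rewrite hc (@tmap_scale _ _ _ _ (fun=> b) (fun=> F) (fun=> linear_of Fl)) //.
by rewrite prodr_const card_ord b4.
Qed.

(** The bundle H itself with the trivialization E_M o E_L^-1, where E_M is a fourth
    root of T_{M,L0} for a fixed L0. *)
Lemma weil_obj_exists : inhabited (weil_obj T).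
Proof.
have [L0 _] := transversal_elags S.
have ex M : exists FG : {linear hfib L0 -> hfib M} * {linear hfib M -> hfib L0},
  [/\ cancel FG.1 FG.2, cancel FG.2 FG.1, intertwiner FG.1 &
      forall t, ctriv T M L0 t = tmap (fun _ : 'I_4 => FG.1) t].
  by have [F [G h]] := fourth_root L0 M; exists (F, G).
pose EG M := sval (cid (ex M)).
have hEG M : [/\ cancel (EG M).1 (EG M).2, cancel (EG M).2 (EG M).1, intertwiner (EG M).1 &
  forall t, ctriv T M L0 t = tmap (fun _ : 'I_4 => (EG M).1) t] := svalP (cid (ex M)).
pose tr (M L : elag S) : {linear hbundle Rr S L -> hbundle Rr S M} := (EG M).1 \o (EG L).2.
have K1 M : cancel (EG M).1 (EG M).2 by have [] := hEG M.
have K2 M : cancel (EG M).2 (EG M).1 by have [] := hEG M.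
have tr_bij M L : bijective (tr M L).
  by exists (tr L M) => x; rewrite /tr /= K1 K2.
have tr_eqv M L : equivariant (tr M L).
  move=> g x; rewrite /tr /=; have [_ _ [_ eM] _] := hEG M; have [_ _ [_ eL] _] := hEG L.
  by rewrite -eM; congr ((EG M).1 _); apply: (can_inj (@K1 L)); rewrite eL !K2.
have tr_comp N M L x : tr N M (tr M L x) = tr N L x by rewrite /tr /= K1.
pose t := Trivialization tr_bij tr_eqv tr_comp.
have idb L : bijective (idfun : {linear hbundle Rr S L -> hbundle Rr S L}) by exists idfun.
have ide L : equivariant (fun x : hbundle Rr S L => (idfun : {linear hbundle Rr S L -> hbundle Rr S L}) x) by [].
have idt : triv_morphism (tens_triv 4 t) (ctriv T)
    (fun L => tmap (fun _ : 'I_4 => (idfun : {linear hbundle Rr S L -> hbundle Rr S L}))).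
  move=> M L x; rewrite !tmap_id // /= /tens_triv_fun /=.
  have [_ _ _ hM] := hEG M; have [_ _ _ hL] := hEG L.
  have K4 := @tmap_cancel _ 4 _ _ (fun=> (EG L).2) (fun=> (EG L).1) (fun=> @K2 L).
  rewrite -{1}(K4 x) -hL triv_comp hM; exact: tmap_comp.
by constructor; exact: (WeilObj idb ide idt).
Qed.
End FourthRoot.

(** * Morphisms of the Weil gerbe *)

Section Gerbe.
Variables (Rr : realType) (A : unramified_ext) (n : nat) (S : split_symplectic A n).
Variable T : canonical_trivialization Rr S.
Local Notation C := (Rr[i]).
Local Notation weil_obj := (weil_obj T).
Implicit Types (E : weil_obj) (L M : elag S).

Lemma phi_inv_ex E L : exists g : {linear hbundle Rr S L -> E L},
  cancel (w_phi E L) g /\ cancel g (w_phi E L).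
Proof.
have [g K1 K2] := w_phi_bij E L.
by exists (linear_of (can2_linear K1 K2)).
Qed.

Definition phi_inv E L : {linear hbundle Rr S L -> E L} := sval (cid (phi_inv_ex E L)).

Lemma phiK E L : cancel (w_phi E L) (phi_inv E L).
Proof. exact: (svalP (cid (phi_inv_ex E L))).1. Qed.
Lemma phiVK E L : cancel (phi_inv E L) (w_phi E L).
Proof. exact: (svalP (cid (phi_inv_ex E L))).2. Qed.

Lemma phi_inv_eqv E L g x : phi_inv E L (hfib_act g x) = act E L g (phi_inv E L x).
Proof. by apply: (can_inj (@phiK E L)); rewrite w_phi_eqv !phiVK. Qed.

(** Take phi_2^-1 phi_1 over one Lagrangian and transport it to the others by the
    trivializations. The condition on fourth powers follows by the same transport,
    as both phi_i^{(x) 4} are compatible with T. *)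
Lemma weil_hom_exists E1 E2 : inhabited (weil_hom E1 E2).
Proof.
have [L0 _] := transversal_elags S.
pose g : {linear E1 L0 -> E2 L0} := phi_inv E2 L0 \o w_phi E1 L0.
pose f L : {linear E1 L -> E2 L} := w_triv E2 L L0 \o (g \o w_triv E1 L0 L).
have feqv L : equivariant (f L).
  by move=> h x; rewrite /f /g /= triv_eqv w_phi_eqv phi_inv_eqv triv_eqv.
have ftriv : triv_morphism (w_triv E1) (w_triv E2) f.
  by move=> M L x; rewrite /f /= !triv_comp.
suff fphi L x : tmap (fun _ : 'I_4 => w_phi E2 L) (tmap (fun _ : 'I_4 => f L) x) =
    tmap (fun _ : 'I_4 => w_phi E1 L) x by constructor; exact: (WeilHom feqv ftriv fphi).
transitivity (ctriv T L L0 (tmap (fun _ : 'I_4 => w_phi E1 L0)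
    (tmap (fun _ : 'I_4 => w_triv E1 L0 L) x))).
  have -> : tmap (fun _ : 'I_4 => w_phi E1 L0) (tmap (fun _ : 'I_4 => w_triv E1 L0 L) x) =
      tmap (fun _ : 'I_4 => w_phi E2 L0) (tmap (fun _ : 'I_4 => g \o w_triv E1 L0 L) x).
    by apply: tmap_square => i y; rewrite /g /= phiVK.
  rewrite (@w_phi_tens _ _ _ _ _ E2 L L0); congr (tmap _ _).
  by apply/esym/tmap_comp.
have e1 := @w_phi_tens _ _ _ _ _ E1 L0 L x.
by apply: etrans (congr1 (ctriv T L L0) (esym e1)) _; rewrite triv_comp triv_id.
Qed.

(** By the Schur lemma for phi_2 f phi_1^-1. *)
Lemma weil_hom_phi E1 E2 (f : weil_hom E1 E2) L :
  exists c : C, c ^+ 4 = 1 /\ forall x, w_phi E2 L (f L x) = c *: w_phi E1 L x.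
Proof.
have Fi : intertwiner (fun y => w_phi E2 L (f L (phi_inv E1 L y))).
  split=> [a x y|g x]; first by rewrite !linearP.
  by rewrite phi_inv_eqv wh_eqv w_phi_eqv.
have [c hc] := schur T Fi; exists c; split; last by move=> x; rewrite -hc phiK.
have := wh_phi f (tpure (fun _ : 'I_4 => phi_inv E1 L (hdelta Rr L))).
rewrite !tmap_tpure hc phiVK.
move=> /(congr1 (fun t : tpow 4 (hfib Rr L) => t (prodform (fun=> hev Rr L 1%g)))).
rewrite !tpureE /= !prodr_const card_ord !hevE hfib_scaleE hdelta1.
by rewrite mulr1 expr1n.
Qed.

Lemma mu4_exists (c : C) : c ^+ 4 = 1 -> exists z : mu4 C, mu4_val z = c.
Proof. by move=> /eqP h; exists (Mu4 h). Qed.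

(** A morphism is determined over one Lagrangian, where two of them differ by a
    scalar, which [weil_hom_phi] makes a fourth root of unity. *)
Lemma weil_hom_unique E1 E2 (f f' : weil_hom E1 E2) :
  exists z : mu4 C, forall L x, f' L x = mu4_val z *: f L x.
Proof.
have [L0 _] := transversal_elags S.
have [c [c4 hc]] := weil_hom_phi f L0; have [c' [c4' hc']] := weil_hom_phi f' L0.
have c0 : c != 0 by apply: contra_eq_neq c4 => ->; rewrite expr0n eq_sym oner_eq0.
have [z ez] : exists z : mu4 C, mu4_val z = c' / c.
  by apply: mu4_exists; rewrite exprMn exprVn c4 c4' invr1 mulr1.
exists z => L x.
suff h0 y : f' L0 y = mu4_val z *: f L0 y.
  rewrite -(triv_id (w_triv E1) x) -(triv_comp (w_triv E1) L L0).
  rewrite -(@wh_triv _ _ _ _ _ _ _ f' L L0) -(@wh_triv _ _ _ _ _ _ _ f L L0) h0 linearZ.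
  by [].
apply: (can_inj (@phiK E2 L0)); rewrite linearZ /= hc hc' scalerA ez.
by rewrite divfK.
Qed.

Section Scale.
Variables (z : mu4 C) (E1 E2 : weil_obj) (f : weil_hom E1 E2).

Fact weil_scale_linear L : linear (fun x => mu4_val z *: f L x).
Proof. by move=> a x y; rewrite linearP scalerDr !scalerA mulrC. Qed.
Definition weil_scale_fun L : {linear E1 L -> E2 L} := linear_of (@weil_scale_linear L).
Fact weil_scale_eqv L : equivariant (weil_scale_fun L).
Proof. by move=> h x /=; rewrite wh_eqv linearZ. Qed.
Fact weil_scale_triv : triv_morphism (w_triv E1) (w_triv E2) weil_scale_fun.
Proof. by move=> M L x /=; rewrite linearZ /= wh_triv. Qed.
Fact weil_scale_phi L x :
  tmap (fun _ : 'I_4 => w_phi E2 L) (tmap (fun _ : 'I_4 => weil_scale_fun L) x) =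
  tmap (fun _ : 'I_4 => w_phi E1 L) x.
Proof.
rewrite -(wh_phi f) (@tmap_scale _ _ _ _ (fun=> mu4_val z) (fun=> f L) (fun=> weil_scale_fun L)) //.
by rewrite prodr_const card_ord (eqP (mu4P z)) scale1r.
Qed.
Definition weil_scale : weil_hom E1 E2 := WeilHom weil_scale_eqv weil_scale_triv weil_scale_phi.
End Scale.

Lemma weil_scaleE z E1 E2 (f : weil_hom E1 E2) L x : weil_scale z f L x = mu4_val z *: f L x.
Proof. by []. Qed.

(** A morphism g in the other direction exists, and g f and f g are scalars, so f is
    inverse to a multiple of g. *)
Lemma weil_hom_iso E1 E2 (f : weil_hom E1 E2) : weil_iso f.
Proof.
have [g] := weil_hom_exists E2 E1.
have [z hz] := weil_hom_unique (weil_comp g f) (weil_id E1).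
have [w hw] := weil_hom_unique (weil_comp f g) (weil_id E2).
have gf L x : x = mu4_val z *: g L (f L x) := hz L x.
have fg L x : x = mu4_val w *: f L (g L x) := hw L x.
apply: (@weil_isoP _ _ _ _ _ _ _ f (weil_scale z g)) => L x; rewrite weil_scaleE -?gf //.
transitivity (mu4_val w *: f L (g L x)); last by rewrite -fg.
by rewrite {1}[x]fg [g L (_ *: _)]linearZ /= scalerA mulrC -scalerA -gf linearZ.
Qed.

Lemma weil_iso_exists E1 E2 : exists fg : weil_hom E1 E2 * weil_hom E2 E1,
  forall L, cancel (fg.1 L) (fg.2 L) /\ cancel (fg.2 L) (fg.1 L).
Proof.
have [f] := weil_hom_exists E1 E2.
by have [g h] := weil_iso_can (weil_hom_iso f); exists (f, g).
Qed.

Section MuElement.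
Variable z : mu4 C.
Fact amp_mu_nat E1 E2 (f : weil_hom E1 E2) :
  weil_comp (weil_scale z (pull1 E2)) (pull_hom 1%g f) = weil_comp f (weil_scale z (pull1 E1)).
Proof.
apply: weil_homP => L x; rewrite /= /weil_comp_fun /=.
rewrite linearZ; congr (_ *: _).
exact: (congr1 (fun a : weil_hom _ _ => a L x) (amp_one_nat f)).
Qed.
Definition amp_mu : AMp T :=
  MkAMp (PullIso amp_mu_nat (fun E => weil_hom_iso (weil_scale z (pull1 E)))).
End MuElement.

Lemma amp_muE z E L x : amp_iota (amp_mu z) E L x = mu4_val z *: fib_cast E (elag_act1 L) x.
Proof. by []. Qed.

Lemma amp_eq (a b : AMp T) (e : a = b) E L x :
  amp_iota a E L x = amp_iota b E L (fib_cast E (congr1 (fun c => elag_act (amp_g c) L) e) x).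
Proof. by subst b. Qed.

(** A nonzero vector in a fiber of some object tells the scalars apart; it exists
    because the gerbe is not empty. *)
Lemma amp_mu_inj : injective amp_mu.
Proof.
move=> z w e.
have [E] := weil_obj_exists T; have [L _] := transversal_elags S.
apply: val_inj => /=.
pose y := phi_inv E L (hdelta Rr L).
have y0 : y != 0.
  apply: contra_neq (hdelta_neq0 Rr L) => h; by rewrite -[hdelta _ _](@phiVK E L) -/y h linear0.
have := amp_eq e (E := E) (fib_cast E (esym (elag_act1 L)) y).
rewrite !amp_muE (@fib_cast_cast _ _ _ _ T E _ _ _ _ _ erefl).
rewrite (@fib_cast_cast _ _ _ _ T E _ _ _ _ _ (esym (elag_act1 L))).
rewrite (@fib_cast_cast _ _ _ _ T E _ _ _ _ _ erefl) /= => /eqP.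
by rewrite -subr_eq0 -scalerBl scaler_eq0 (negPf y0) orbF subr_eq0 => /eqP.
Qed.

Lemma fib_cast_trans E L M N (e : L = M) (f : M = N) x :
  fib_cast E f (fib_cast E e x) = fib_cast E (etrans e f) x.
Proof. exact: fib_cast_cast. Qed.

Lemma fib_cast_irrelevance E L M (e f : L = M) x : fib_cast E e x = fib_cast E f x.
Proof. by rewrite (Prop_irrelevance e f). Qed.

Lemma amp_mu_mul z w : amp_mu (mu4_mul z w) = amp_mul (amp_mu z) (amp_mu w).
Proof.
apply: (@ampP _ _ _ _ _ (amp_mu (mu4_mul z w)) (amp_mul (amp_mu z) (amp_mu w)) (esym (mulg1 1%g))) => E L x.
rewrite amp_mulE !amp_muE linearZ scalerA mulrC; congr (_ *: _).
by rewrite !fib_cast_trans; apply: fib_cast_irrelevance.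
Qed.

Lemma amp_mu_central z a : amp_mul (amp_mu z) a = amp_mul a (amp_mu z).
Proof.
apply: (@ampP _ _ _ _ _ (amp_mul (amp_mu z) a) (amp_mul a (amp_mu z))
  (etrans (mul1g _) (esym (mulg1 _)))) => E L x.
rewrite !amp_mulE !amp_muE linearZ; congr (_ *: _).
rewrite -(amp_iota_cast (elag_act1 L) (congr1 (elag_act (amp_g a)) (elag_act1 L))).
congr (amp_iota a E L _); rewrite !fib_cast_trans.
exact: (@fib_cast_irrelevance E _ _ _ _ x).
Qed.

(** An isomorphism i : Id -> Id acts on one object E0 by a scalar z; since every
    object is isomorphic to E0, naturality makes i act by z everywhere. *)
Lemma amp_mu_exact (a : AMp T) : amp_g a = 1%g <-> exists z, a = amp_mu z.
Proof.
split=> [|[z ->] //]; case: a => g i /= e; subst g.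
have [E0] := weil_obj_exists T.
have [z hz] := weil_hom_unique (pull1 E0) (i E0); exists z.
apply: (@ampP _ _ _ _ _ (MkAMp i) (amp_mu z) erefl) => E L x.
rewrite amp_muE /=.
have [[f f'] h] := weil_iso_exists E0 E.
rewrite -{1}[x]((h _).2 x) pi_natE hz linearZ; congr (_ *: _).
rewrite -[pull1 E0 L _]/(fib_cast E0 (elag_act1 L) _) (fib_cast_nat f) /=.
by rewrite (h _).2.
Qed.

(** Choose an object E0, isomorphisms f_E : E0 -> E and a morphism
    a : g^* E0 -> E0, and set i_E = f_E a g^*(f_E)^-1. A morphism s : E1 -> E2
    turns f_{E1} into a scalar multiple of f_{E2}, and scalars commute with a and
    with g^*; hence i is natural. *)
Lemma amp_lift (g : ASp S) : exists a : AMp T, amp_g a = g.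
Proof.
have [E0] := weil_obj_exists T.
pose f E := (sval (cid (weil_iso_exists E0 E))).1.
pose f' E := (sval (cid (weil_iso_exists E0 E))).2.
have fK E L : cancel (f E L) (f' E L) by rewrite /f /f'; case: cid => fg /= /(_ L)[].
have fVK E L : cancel (f' E L) (f E L) by rewrite /f /f'; case: cid => fg /= /(_ L)[].
have [a] := weil_hom_exists (pull g E0) E0.
pose i E : weil_hom (pull g E) E := weil_comp (f E) (weil_comp a (pull_hom g (f' E))).
have inat E1 E2 (s : weil_hom E1 E2) : weil_comp (i E2) (pull_hom g s) = weil_comp s (i E1).
  have [z hz] := weil_hom_unique (f E2) (weil_comp s (f E1)).
  have hz1 L x : s L (f E1 L x) = mu4_val z *: f E2 L x := hz L x.
  have hz2 L x : f' E2 L (s L x) = mu4_val z *: f' E1 L x.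
    by rewrite -{1}[x](@fVK E1 L) hz1 linearZ /= fK.
  apply: weil_homP => L x; rewrite /= /weil_comp_fun /= /pull_hom_fun /= /weil_comp_fun /=.
  by rewrite hz2 !linearZ /= hz1.
by exists (MkAMp (PullIso inat (fun E => weil_hom_iso (i E)))).
Qed.
End Gerbe.

(** * The extension of ASp(V) by the fourth roots of unity *)

Theorem proposition3p8 (Rr : realType) (A : unramified_ext) (n : nat)
    (S : split_symplectic A n) (T : canonical_trivialization Rr S) :
  exists i : grp_of (mu4 Rr[i]) -> AMp_grp T,
    @central_extension (grp_of (mu4 Rr[i])) (AMp_grp T) (grp_of (ASp S))
      i (fun a => amp_g a).
Proof.
exists (@amp_mu Rr A n S T); split => //.
- exact: amp_mu_mul.
- exact: amp_mu_inj.
- exact: amp_lift.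
- exact: amp_mu_exact.
- exact: amp_mu_central.
Qed.
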